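(* Let $g(x,y)$ be a real analytic function defined in a neighbourhood of $(0,0)\in\mathbb{R}^2$ such that $g(0,0)=g_y(0,0)=g_{yy}(0,0)=0$ and $g_{yyy}(0,0)\neq 0$. Then $g$ is an admissible discriminant if and only if there exists a (smooth, local near $(0,0)$) transformation of the second coordinate $\tilde y=\tilde y(x,y)$, with $\frac{\partial\tilde y}{\partial y}\neq 0$, that reduces $g$ to one of the following two forms: either $g=\tilde y^3$ or $g=\tilde y^3+\frac{x^2}{4}$. In the coordinates $(x,\tilde y)$ the corresponding Nijenhuis operators (i.e. the Nijenhuis operators $L$ with $\operatorname{tr}L=x$ and $\left(\frac{\operatorname{tr}L}{2}\right)^2-\det L=g$) are, respectively, $$L_1=\begin{bmatrix}\frac{x}{2} & 3\tilde y^2\\ \frac{\tilde y}{3} & \frac{x}{2}\end{bmatrix}\qquad\text{and}\qquad L_2=\begin{bmatrix}x & 3\tilde y^2\\ \frac{\tilde y}{3} & 0\end{bmatrix}.$$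
   Context: Smooth means $C^\infty$; all statements are local, in a (sufficiently small) neighbourhood of the origin. An operator $L$ on an open set of $\mathbb{R}^2$ is a smooth $(1,1)$-tensor field; its matrix in coordinates $(x^1,x^2)$ is $(L^i_j)$ with row index $i$ and column index $j$, so $L\,\partial_{x^j}=\sum_i L^i_j\,\partial_{x^i}$. The Nijenhuis torsion of $L$ is $\mathcal{N}_L(v,u)=[Lv,Lu]+L^2[v,u]-L[Lv,u]-L[v,Lu]$ for smooth vector fields $v,u$, and $L$ is called a Nijenhuis operator if $\mathcal{N}_L\equiv 0$. A function $g(x,y)$ defined near $(0,0)$ is called an admissible discriminant if there exists a smooth Nijenhuis operator $L$ (in a neighbourhood of $(0,0)$) such that $\operatorname{tr}L=x$ and $\left(\frac{\operatorname{tr}L}{2}\right)^2-\det L=g(x,y)$. Subscripts denote partial derivatives. *)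

(* Defs.v *)
From Stdlib Require Import Reals.
From Coquelicot Require Import Coquelicot.
Open Scope R_scope.

(* Functions on open subsets of the plane are total functions [R -> R -> R];
   their values outside the open set under consideration are irrelevant. *)
Definition dx (f : R -> R -> R) (x y : R) : R := Derive (fun t => f t y) x.
Definition dy (f : R -> R -> R) (x y : R) : R := Derive (fun t => f x t) y.

Definition nbhd0 (U : R * R -> Prop) : Prop := open U /\ U (0, 0).

(* [Derive] is total, so existence of the partial derivatives has to be
   required separately. *)
Fixpoint Ck_on (k : nat) (U : R * R -> Prop) (f : R -> R -> R) : Prop :=
  (forall x y, U (x, y) -> continuity_2d_pt f x y) /\
  match k with
  | O => True
  | S k' =>
      (forall x y, U (x, y) ->
         ex_derive (fun t => f t y) x /\ ex_derive (fun t => f x t) y) /\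
      Ck_on k' U (dx f) /\ Ck_on k' U (dy f)
  end.

Definition smooth_on (U : R * R -> Prop) (f : R -> R -> R) : Prop :=
  forall k, Ck_on k U f.

Definition square_sum (u : nat -> nat -> R) (N : nat) : R :=
  sum_n (fun i => sum_n (fun j => u i j) N) N.

(* Around each point of [U], [g] is the sum of an absolutely convergent double
   power series; absolute convergence makes the order of summation (here by
   squares) immaterial. *)
Definition analytic_on (U : R * R -> Prop) (g : R -> R -> R) : Prop :=
  forall a b, U (a, b) ->
  exists (c : nat -> nat -> R) (r : R), 0 < r /\
    forall x y, Rabs (x - a) < r -> Rabs (y - b) < r ->
      ex_finite_lim_seq
        (square_sum (fun i j => Rabs (c i j * (x - a) ^ i * (y - b) ^ j))) /\
      is_lim_seq
        (square_sum (fun i j => c i j * (x - a) ^ i * (y - b) ^ j)) (g x y).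

Record vfield := VField { vf1 : R -> R -> R; vf2 : R -> R -> R }.

(* [opij] is the entry in row [i] and column [j]. *)
Record operator := Operator {
  op11 : R -> R -> R; op12 : R -> R -> R;
  op21 : R -> R -> R; op22 : R -> R -> R }.

Definition smooth_vfield_on (U : R * R -> Prop) (v : vfield) : Prop :=
  smooth_on U (vf1 v) /\ smooth_on U (vf2 v).

Definition smooth_operator_on (U : R * R -> Prop) (L : operator) : Prop :=
  smooth_on U (op11 L) /\ smooth_on U (op12 L) /\
  smooth_on U (op21 L) /\ smooth_on U (op22 L).

Definition vadd (v u : vfield) : vfield :=
  VField (fun x y => vf1 v x y + vf1 u x y) (fun x y => vf2 v x y + vf2 u x y).

Definition vsub (v u : vfield) : vfield :=
  VField (fun x y => vf1 v x y - vf1 u x y) (fun x y => vf2 v x y - vf2 u x y).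

Definition act (L : operator) (v : vfield) : vfield :=
  VField (fun x y => op11 L x y * vf1 v x y + op12 L x y * vf2 v x y)
         (fun x y => op21 L x y * vf1 v x y + op22 L x y * vf2 v x y).

Definition deriv_along (v : vfield) (f : R -> R -> R) (x y : R) : R :=
  vf1 v x y * dx f x y + vf2 v x y * dy f x y.

Definition bracket (v u : vfield) : vfield :=
  VField (fun x y => deriv_along v (vf1 u) x y - deriv_along u (vf1 v) x y)
         (fun x y => deriv_along v (vf2 u) x y - deriv_along u (vf2 v) x y).

Definition torsion (L : operator) (v u : vfield) : vfield :=
  vsub (vsub (vadd (bracket (act L v) (act L u)) (act L (act L (bracket v u))))
             (act L (bracket (act L v) u)))
       (act L (bracket v (act L u))).

Definition nijenhuis_on (U : R * R -> Prop) (L : operator) : Prop :=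
  forall v u, smooth_vfield_on U v -> smooth_vfield_on U u ->
  forall x y, U (x, y) ->
    vf1 (torsion L v u) x y = 0 /\ vf2 (torsion L v u) x y = 0.

Definition op_tr (L : operator) (x y : R) : R := op11 L x y + op22 L x y.

Definition op_det (L : operator) (x y : R) : R :=
  op11 L x y * op22 L x y - op12 L x y * op21 L x y.

Definition nijenhuis_with_discriminant (g : R -> R -> R) (L : operator) : Prop :=
  exists U, nbhd0 U /\ smooth_operator_on U L /\ nijenhuis_on U L /\
    forall x y, U (x, y) ->
      op_tr L x y = x /\ (op_tr L x y / 2) ^ 2 - op_det L x y = g x y.

Definition admissible_discriminant (g : R -> R -> R) : Prop :=
  exists L, nijenhuis_with_discriminant g L.

Definition second_coordinate (yt : R -> R -> R) : Prop :=
  exists U, nbhd0 U /\ smooth_on U yt /\ forall x y, U (x, y) -> dy yt x y <> 0.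

(* The coordinate fields of the coordinates [(x, yt)], written in the
   coordinates [(x, y)]: the frame dual to the differentials of [x] and [yt]. *)
Definition coord_field1 (yt : R -> R -> R) : vfield :=
  VField (fun _ _ => 1) (fun x y => - dx yt x y / dy yt x y).
Definition coord_field2 (yt : R -> R -> R) : vfield :=
  VField (fun _ _ => 0) (fun x y => / dy yt x y).

(* Near the origin, [L] applied to the [j]-th coordinate field is the
   combination of the coordinate fields given by the [j]-th column of [M], the
   entries of [M] being functions of the new coordinates [(x, yt)]. *)
Definition matrix_in_coordinates (yt : R -> R -> R) (L M : operator) : Prop :=
  let e1 := coord_field1 yt in
  let e2 := coord_field2 yt in
  locally_2d (fun x y =>
    let z := yt x y in
    (vf1 (act L e1) x y = op11 M x z * vf1 e1 x y + op21 M x z * vf1 e2 x y /\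
     vf2 (act L e1) x y = op11 M x z * vf2 e1 x y + op21 M x z * vf2 e2 x y) /\
    (vf1 (act L e2) x y = op12 M x z * vf1 e1 x y + op22 M x z * vf1 e2 x y /\
     vf2 (act L e2) x y = op12 M x z * vf2 e1 x y + op22 M x z * vf2 e2 x y))
    0 0.

Definition L1 : operator :=
  Operator (fun x z => x / 2) (fun x z => 3 * z ^ 2)
           (fun x z => z / 3) (fun x z => x / 2).

Definition L2 : operator :=
  Operator (fun x z => x)     (fun x z => 3 * z ^ 2)
           (fun x z => z / 3) (fun x z => 0).

(* Main.v *)
(* If [tr L = x], the torsion of [L] on the coordinate fields is
   [(g_y - op12, op11 - x/2 - g_x)], so [L] is Nijenhuis iff [op11 = x/2 + g_x] and
   [op12 = g_y], and [g] is admissible iff [g_x^2 + c g_y = g] for a smooth [c = op21].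

   For [g = w^3 + eps x^2/4], [eps] in {0, 1}, this equation determines [c] and gives
   the two matrices.

   Conversely let [y = s x] solve [g_yy = 0], and put [A = g_y(x, s)], [B = g(x, s)].
   The equation and its first two [y]-derivatives along the curve read
     [2 A' B' = A m],  [B'^2 - B = A (a A'^2 + b A)],
   with [a 0 <> 0] and [m 0 = 2/3], the latter by the third [y]-derivative. These
   force [A = 0] near the origin, hence [B'^2 = B] and [B = 0] or [B = x^2/4]. Then
   [g - B] vanishes to third order along the curve, so it is a cube. *)
Require Import Defs.
From Stdlib Require Import Reals Lra Psatz Ranalysis5.
From Coquelicot Require Import Coquelicot.
Open Scope R_scope.

(** * Calculus of [Ck_on] *)

(** For fixed [x] the function [g(x, .)] may a priori have two critical points near the origin, or
    none, so there is no curve of critical points to start from. Inflection points do form a smooth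
    curve, because [g_yyy] does not vanish; that they are degenerate critical points is exactly the
    claim [A = 0]. The system for [A] and [B] is singular at the origin: [B'] vanishes there
    together with [A] and [A'], so no uniqueness theorem for differential equations applies, and
    flat smooth solutions must be excluded by inequalities. The first relation reads
    [A' / A = m / (2 B')]. If [B''(0) = 1/2], the right-hand side is close to [(2/3) / x], so a
    nonzero [A] would behave like [x ^ (2/3)], against [A'(0) = 0]; this is where [m 0 < 1] decides.
    Otherwise [B'] is at most of order [A' ^ 3], hence [A] at most of order [A' ^ 4], whereas a
    nonnegative function with bounded second derivative dominates the square of its derivative. *)

Definition box (d : R) (p : R * R) : Prop := Rabs (fst p) < d /\ Rabs (snd p) < d.

Lemma open_locally_2d U x y :
  open U -> U (x, y) -> locally_2d (fun u v => U (u, v)) x y.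
Proof.
intros HU Hxy. apply locally_2d_locally.
generalize (HU (x, y) Hxy). apply filter_imp. now intros [u v].
Qed.

Lemma locally_2d_open (U : R * R -> Prop) :
  (forall x y, U (x, y) -> locally_2d (fun u v => U (u, v)) x y) -> open U.
Proof.
intros H [x y] Hxy. generalize (proj1 (locally_2d_locally _ _ _) (H x y Hxy)).
apply filter_imp. now intros [u v].
Qed.

Lemma locally_2d_imp (P Q : R -> R -> Prop) x y :
  (forall u v, P u v -> Q u v) -> locally_2d P x y -> locally_2d Q x y.
Proof. intros H [d Hd]. exists d. auto. Qed.

Lemma locally_2d_1d_x P x y : locally_2d P x y -> locally x (fun t => P t y).
Proof. exact (locally_2d_1d_const_y P x y). Qed.

Lemma locally_2d_1d_y P x y : locally_2d P x y -> locally y (fun t => P x t).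
Proof. exact (locally_2d_1d_const_x P x y). Qed.

Lemma continuity_2d_pt_comp f p q x y :
  continuity_2d_pt f (p x y) (q x y) ->
  continuity_2d_pt p x y -> continuity_2d_pt q x y ->
  continuity_2d_pt (fun u v => f (p u v) (q u v)) x y.
Proof.
intros Hf Hp Hq eps. destruct (Hf eps) as [d Hd].
generalize (locally_2d_and _ _ _ _ (Hp d) (Hq d)).
apply locally_2d_imp. intros u v [H1 H2]. now apply Hd.
Qed.

Lemma continuity_2d_pt_x p x y : continuity_2d_pt p x y -> continuity_pt (fun t => p t y) x.
Proof.
intros H. apply continuity_pt_locally. intros eps.
apply (locally_2d_1d_x (fun u v => Rabs (p u v - p x y) < eps)), H.
Qed.

Lemma continuity_2d_pt_y p x y : continuity_2d_pt p x y -> continuity_pt (fun t => p x t) y.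
Proof.
intros H. apply continuity_pt_locally. intros eps.
apply (locally_2d_1d_y (fun u v => Rabs (p u v - p x y) < eps)), H.
Qed.

Lemma open_box d : open (box d).
Proof.
apply locally_2d_open. intros x y [Hx Hy]. simpl in Hx, Hy.
assert (Hd : 0 < Rmin (d - Rabs x) (d - Rabs y)) by (apply Rmin_pos; lra).
exists (mkposreal _ Hd). simpl. intros u v Hu Hv.
pose proof (Rmin_l (d - Rabs x) (d - Rabs y)). pose proof (Rmin_r (d - Rabs x) (d - Rabs y)).
pose proof (Rabs_triang_inv u x). pose proof (Rabs_triang_inv v y).
split; simpl; lra.
Qed.

Lemma box_nbhd0 d : 0 < d -> nbhd0 (box d).
Proof. intros H. split; [apply open_box|]. split; simpl; now rewrite Rabs_R0. Qed.

Lemma nbhd0_box U : nbhd0 U -> exists d, 0 < d /\ forall p, box d p -> U p.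
Proof.
intros [HU H0]. destruct (open_locally_2d U 0 0 HU H0) as [d Hd].
exists d. split; [apply cond_pos|]. intros [x y] [Hx Hy].
apply Hd; rewrite Rminus_0_r; assumption.
Qed.

Lemma locally_2d_box (P : R -> R -> Prop) :
  locally_2d P 0 0 <-> exists d, 0 < d /\ forall x y, box d (x, y) -> P x y.
Proof.
split.
- intros [d Hd]. exists d. split; [apply cond_pos|]. intros x y [Hx Hy].
  apply Hd; rewrite Rminus_0_r; assumption.
- intros [d [Hd H]]. exists (mkposreal d Hd). simpl. intros x y.
  rewrite !Rminus_0_r. intros Hx Hy. apply H. now split.
Qed.

Lemma box_le d e p : d <= e -> box d p -> box e p.
Proof. intros H [H1 H2]. split; lra. Qed.

Lemma differentiable_pt_lim_plus f g x y a b c d :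
  differentiable_pt_lim f x y a b -> differentiable_pt_lim g x y c d ->
  differentiable_pt_lim (fun u v => f u v + g u v) x y (a + c) (b + d).
Proof.
intros Hf Hg.
replace (a + c) with (1 * a + 1 * c) by ring.
replace (b + d) with (1 * b + 1 * d) by ring.
apply (differentiable_pt_lim_comp Rplus f g); auto.
intros eps. exists (mkposreal 1 Rlt_0_1). intros u v _ _.
replace (_ - _) with 0 by ring. rewrite Rabs_R0.
apply Rmult_le_pos; [apply Rlt_le, cond_pos|].
apply Rle_trans with (1 := Rabs_pos (u - f x y)), Rmax_l.
Qed.

Lemma differentiable_pt_lim_mult f g x y a b c d :
  differentiable_pt_lim f x y a b -> differentiable_pt_lim g x y c d ->
  differentiable_pt_lim (fun u v => f u v * g u v) x y
    (a * g x y + f x y * c) (b * g x y + f x y * d).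
Proof.
intros Hf Hg.
replace (a * g x y + f x y * c) with (g x y * a + f x y * c) by ring.
replace (b * g x y + f x y * d) with (g x y * b + f x y * d) by ring.
apply (differentiable_pt_lim_comp Rmult f g); auto.
intros eps. exists eps. intros u v Hu Hv.
replace (_ - _) with ((u - f x y) * (v - g x y)) by ring. rewrite Rabs_mult.
apply Rmult_le_compat; try apply Rabs_pos; [now apply Rlt_le|apply Rmax_r].
Qed.

Lemma Ck_on_continuity k U f x y : Ck_on k U f -> U (x, y) -> continuity_2d_pt f x y.
Proof. destruct k; intros [H _]; auto. Qed.

Lemma Ck_on_S k U f : Ck_on (S k) U f -> Ck_on k U f.
Proof.
revert f. induction k as [|k IH]; intros f [Hc [He [Hx Hy]]].
- now split.
- split; [assumption|]. split; [assumption|]. split; apply IH; assumption.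
Qed.

Lemma Ck_on_partial k U f : Ck_on (S k) U f -> Ck_on k U (dx f) /\ Ck_on k U (dy f).
Proof. intros [_ [_ H]]. exact H. Qed.

Lemma Ck_on_subset k (U V : R * R -> Prop) f :
  (forall p, V p -> U p) -> Ck_on k U f -> Ck_on k V f.
Proof.
intros HVU. revert f. induction k as [|k IH]; intros f; simpl.
- intros [H _]. split; auto.
- intros [Hc [He [Hx Hy]]]. split; [|split; [|split]].
  + intros x y Hxy. now apply Hc, HVU.
  + intros x y Hxy. now apply He, HVU.
  + now apply IH.
  + now apply IH.
Qed.

Lemma dx_ext_on (U : R * R -> Prop) f g : open U -> (forall x y, U (x, y) -> f x y = g x y) ->
  forall x y, U (x, y) -> dx f x y = dx g x y.
Proof.
intros HU H x y Hxy. apply Derive_ext_loc.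
apply (locally_2d_1d_x (fun u v => f u v = g u v)).
generalize (open_locally_2d U x y HU Hxy). apply locally_2d_imp. auto.
Qed.

Lemma dy_ext_on (U : R * R -> Prop) f g : open U -> (forall x y, U (x, y) -> f x y = g x y) ->
  forall x y, U (x, y) -> dy f x y = dy g x y.
Proof.
intros HU H x y Hxy. apply Derive_ext_loc.
apply (locally_2d_1d_y (fun u v => f u v = g u v)).
generalize (open_locally_2d U x y HU Hxy). apply locally_2d_imp. auto.
Qed.

Lemma Ck_on_ext k U f g : open U -> (forall x y, U (x, y) -> f x y = g x y) ->
  Ck_on k U f -> Ck_on k U g.
Proof.
intros HU. revert f g. induction k as [|k IH]; intros f g Hfg; simpl.
- intros [Hc _]. split; [|trivial]. intros x y Hxy.
  apply continuity_2d_pt_ext_loc with (2 := Hc x y Hxy).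
  generalize (open_locally_2d U x y HU Hxy). apply locally_2d_imp. auto.
- intros [Hc [He [Hx Hy]]]. repeat split.
  + intros x y Hxy. apply continuity_2d_pt_ext_loc with (2 := Hc x y Hxy).
    generalize (open_locally_2d U x y HU Hxy). apply locally_2d_imp. auto.
  + eapply ex_derive_ext_loc; [|apply (He x y H)].
    apply (locally_2d_1d_x (fun u v => f u v = g u v)).
    generalize (open_locally_2d U x y HU H). apply locally_2d_imp. auto.
  + eapply ex_derive_ext_loc; [|apply (He x y H)].
    apply (locally_2d_1d_y (fun u v => f u v = g u v)).
    generalize (open_locally_2d U x y HU H). apply locally_2d_imp. auto.
  + apply IH with (dx f); auto. now apply dx_ext_on.
  + apply IH with (dy f); auto. now apply dy_ext_on.
Qed.

Lemma differentiable_pt_lim_partial f x y a b :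
  differentiable_pt_lim f x y a b ->
  is_derive (fun t => f t y) x a /\ is_derive (fun t => f x t) y b.
Proof.
intros H. split; apply is_derive_Reals.
- replace a with (a * 1 + b * 0) by ring.
  apply (derivable_pt_lim_comp_2d f (fun t => t) (fun _ => y) x); auto.
  + apply derivable_pt_lim_id.
  + apply derivable_pt_lim_const.
- replace b with (a * 0 + b * 1) by ring.
  apply (derivable_pt_lim_comp_2d f (fun _ => x) (fun t => t) y); auto.
  + apply derivable_pt_lim_const.
  + apply derivable_pt_lim_id.
Qed.

Lemma differentiable_pt_lim_dx f x y a b : differentiable_pt_lim f x y a b -> dx f x y = a.
Proof. intros H. apply is_derive_unique, (differentiable_pt_lim_partial _ _ _ _ _ H). Qed.

Lemma differentiable_pt_lim_dy f x y a b : differentiable_pt_lim f x y a b -> dy f x y = b.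
Proof. intros H. apply is_derive_unique, (differentiable_pt_lim_partial _ _ _ _ _ H). Qed.

(** [Ck_on] speaks of the total functions [dx f] and [dy f]. This rule lets closed formulas stand in
    for them: a total differential yields at once the continuity of [f], the existence of the
    partial derivatives and their values. The closure properties below are inductions on [k] through
    it. *)
Lemma Ck_on_intro k U f fx fy : open U ->
  (forall x y, U (x, y) -> differentiable_pt_lim f x y (fx x y) (fy x y)) ->
  Ck_on k U fx -> Ck_on k U fy -> Ck_on (S k) U f.
Proof.
intros HU Hd Hx Hy. repeat split.
- intros x y Hxy. apply differentiable_continuity_pt.
  exists (fx x y), (fy x y). auto.
- eexists. apply (differentiable_pt_lim_partial _ _ _ _ _ (Hd x y H)).
- eexists. apply (differentiable_pt_lim_partial _ _ _ _ _ (Hd x y H)).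
- apply Ck_on_ext with fx; auto. intros x y Hxy. symmetry.
  now apply (differentiable_pt_lim_dx f x y (fx x y) (fy x y)), Hd.
- apply Ck_on_ext with fy; auto. intros x y Hxy. symmetry.
  now apply (differentiable_pt_lim_dy f x y (fx x y) (fy x y)), Hd.
Qed.

(** Both partial derivatives exist and [dx f] is continuous, which already forces total
    differentiability; this feeds the hypothesis of [Ck_on_intro] back into the inductions. *)
Lemma Ck_on_differentiable k U f x y : open U -> Ck_on (S k) U f -> U (x, y) ->
  differentiable_pt_lim f x y (dx f x y) (dy f x y).
Proof.
intros HU [Hc [He [Hx Hy]]] Hxy. apply filterdiff_differentiable_pt_lim.
apply filterdiff_ext_lin with
  (fun u : R * R => plus (scal (fst u) (dx f x y)) (scal (snd u) (dy f x y))).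
- apply (is_derive_filterdiff f x y (dx f) (dy f x y)).
  + generalize (proj1 (locally_2d_locally _ _ _) (open_locally_2d U x y HU Hxy)).
    apply filter_imp. intros [u v] Huv. apply Derive_correct, (He u v Huv).
  + apply Derive_correct, (He x y Hxy).
  + apply continuity_2d_pt_filterlim. apply (Ck_on_continuity _ _ _ _ _ Hx Hxy).
- intros [u v]. reflexivity.
Qed.

Lemma differentiable_pt_lim_const c x y : differentiable_pt_lim (fun _ _ => c) x y 0 0.
Proof.
intros eps. exists eps. intros u v _ _.
replace (_ - _) with 0 by ring. rewrite Rabs_R0.
apply Rmult_le_pos; [apply Rlt_le, cond_pos|].
apply Rle_trans with (1 := Rabs_pos (u - x)), Rmax_l.
Qed.

Lemma Ck_on_const k U c : open U -> Ck_on k U (fun _ _ => c).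
Proof.
intros HU. revert c. induction k as [|k IH]; intros c.
- split; [|trivial]. intros x y _. apply continuity_2d_pt_const.
- apply Ck_on_intro with (fun _ _ => 0) (fun _ _ => 0); auto.
  intros x y _. apply differentiable_pt_lim_const.
Qed.

Lemma Ck_on_fst k U : open U -> Ck_on k U (fun x _ => x).
Proof.
intros HU. destruct k.
- split; [|trivial]. intros x y _. apply continuity_2d_pt_id1.
- apply Ck_on_intro with (fun _ _ => 1) (fun _ _ => 0); auto using Ck_on_const.
  intros x y _. apply differentiable_pt_lim_proj1_0, derivable_pt_lim_id.
Qed.

Lemma Ck_on_snd k U : open U -> Ck_on k U (fun _ y => y).
Proof.
intros HU. destruct k.
- split; [|trivial]. intros x y _. apply continuity_2d_pt_id2.
- apply Ck_on_intro with (fun _ _ => 0) (fun _ _ => 1); auto using Ck_on_const.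
  intros x y _ eps. exists eps. intros u v _ _.
  replace (_ - _) with 0 by ring. rewrite Rabs_R0.
  apply Rmult_le_pos; [apply Rlt_le, cond_pos|].
  apply Rle_trans with (1 := Rabs_pos (u - x)), Rmax_l.
Qed.

Lemma Ck_on_plus k U f g : open U -> Ck_on k U f -> Ck_on k U g ->
  Ck_on k U (fun x y => f x y + g x y).
Proof.
intros HU. revert f g. induction k as [|k IH]; intros f g Hf Hg.
- split; [|trivial]. intros x y Hxy.
  apply continuity_2d_pt_plus; now apply (Ck_on_continuity 0 U).
- destruct (Ck_on_partial _ _ _ Hf) as [Hfx Hfy].
  destruct (Ck_on_partial _ _ _ Hg) as [Hgx Hgy].
  apply Ck_on_intro with (fun x y => dx f x y + dx g x y) (fun x y => dy f x y + dy g x y); auto.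
  intros x y Hxy. apply differentiable_pt_lim_plus; now apply (Ck_on_differentiable k U).
Qed.

Lemma Ck_on_mult k U f g : open U -> Ck_on k U f -> Ck_on k U g ->
  Ck_on k U (fun x y => f x y * g x y).
Proof.
intros HU. revert f g. induction k as [|k IH]; intros f g Hf Hg.
- split; [|trivial]. intros x y Hxy.
  apply continuity_2d_pt_mult; now apply (Ck_on_continuity 0 U).
- pose proof (Ck_on_S _ _ _ Hf) as Hf'. pose proof (Ck_on_S _ _ _ Hg) as Hg'.
  destruct (Ck_on_partial _ _ _ Hf) as [Hfx Hfy].
  destruct (Ck_on_partial _ _ _ Hg) as [Hgx Hgy].
  apply Ck_on_intro with (fun x y => dx f x y * g x y + f x y * dx g x y)
    (fun x y => dy f x y * g x y + f x y * dy g x y); auto.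
  + intros x y Hxy. apply differentiable_pt_lim_mult; now apply (Ck_on_differentiable k U).
  + apply Ck_on_plus; auto.
  + apply Ck_on_plus; auto.
Qed.

Lemma Ck_on_comp k U V f p q : open U -> open V ->
  Ck_on k V f -> Ck_on k U p -> Ck_on k U q ->
  (forall x y, U (x, y) -> V (p x y, q x y)) ->
  Ck_on k U (fun x y => f (p x y) (q x y)).
Proof.
intros HU HV. revert f p q. induction k as [|k IH]; intros f p q Hf Hp Hq HUV.
- split; [|trivial]. intros x y Hxy.
  apply continuity_2d_pt_comp.
  + apply (Ck_on_continuity 0 V f); auto.
  + apply (Ck_on_continuity 0 U p); auto.
  + apply (Ck_on_continuity 0 U q); auto.
- pose proof (Ck_on_S _ _ _ Hp) as Hp'. pose proof (Ck_on_S _ _ _ Hq) as Hq'.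
  destruct (Ck_on_partial _ _ _ Hf) as [Hfx Hfy].
  destruct (Ck_on_partial _ _ _ Hp) as [Hpx Hpy].
  destruct (Ck_on_partial _ _ _ Hq) as [Hqx Hqy].
  apply Ck_on_intro with
    (fun x y => dx f (p x y) (q x y) * dx p x y + dy f (p x y) (q x y) * dx q x y)
    (fun x y => dx f (p x y) (q x y) * dy p x y + dy f (p x y) (q x y) * dy q x y); auto.
  + intros x y Hxy. apply differentiable_pt_lim_comp.
    * apply (Ck_on_differentiable k V); auto.
    * apply (Ck_on_differentiable k U); auto.
    * apply (Ck_on_differentiable k U); auto.
  + apply Ck_on_plus; [assumption | |]; apply Ck_on_mult; auto; apply IH; assumption.
  + apply Ck_on_plus; [assumption | |]; apply Ck_on_mult; auto; apply IH; assumption.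
Qed.

(** * Closure properties of smooth functions *)

Lemma smooth_on_subset (U V : R * R -> Prop) f :
  (forall p, V p -> U p) -> smooth_on U f -> smooth_on V f.
Proof. intros H Hf k. now apply Ck_on_subset with U. Qed.

Lemma smooth_on_ext U f g : open U -> (forall x y, U (x, y) -> f x y = g x y) ->
  smooth_on U f -> smooth_on U g.
Proof. intros HU H Hf k. now apply Ck_on_ext with f. Qed.

Lemma smooth_on_const U c : open U -> smooth_on U (fun _ _ => c).
Proof. intros H k. now apply Ck_on_const. Qed.

Lemma smooth_on_fst U : open U -> smooth_on U (fun x _ => x).
Proof. intros H k. now apply Ck_on_fst. Qed.

Lemma smooth_on_snd U : open U -> smooth_on U (fun _ y => y).
Proof. intros H k. now apply Ck_on_snd. Qed.

Lemma smooth_on_plus U f g : open U -> smooth_on U f -> smooth_on U g ->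
  smooth_on U (fun x y => f x y + g x y).
Proof. intros H Hf Hg k. now apply Ck_on_plus. Qed.

Lemma smooth_on_mult U f g : open U -> smooth_on U f -> smooth_on U g ->
  smooth_on U (fun x y => f x y * g x y).
Proof. intros H Hf Hg k. now apply Ck_on_mult. Qed.

Lemma smooth_on_opp U f : open U -> smooth_on U f -> smooth_on U (fun x y => - f x y).
Proof.
intros H Hf. apply smooth_on_ext with (fun x y => -1 * f x y); auto.
- intros x y _. ring.
- apply smooth_on_mult; auto. now apply smooth_on_const.
Qed.

Lemma smooth_on_minus U f g : open U -> smooth_on U f -> smooth_on U g ->
  smooth_on U (fun x y => f x y - g x y).
Proof. intros H Hf Hg. apply smooth_on_plus; auto. now apply smooth_on_opp. Qed.

Lemma smooth_on_pow U f n : open U -> smooth_on U f -> smooth_on U (fun x y => f x y ^ n).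
Proof.
intros H Hf. induction n as [|n IH]; simpl.
- now apply smooth_on_const.
- now apply smooth_on_mult.
Qed.

Lemma smooth_on_dx U f : smooth_on U f -> smooth_on U (dx f).
Proof. intros H k. apply (H (S k)). Qed.

Lemma smooth_on_dy U f : smooth_on U f -> smooth_on U (dy f).
Proof. intros H k. apply (H (S k)). Qed.

Lemma smooth_on_comp U V f p q : open U -> open V ->
  smooth_on V f -> smooth_on U p -> smooth_on U q ->
  (forall x y, U (x, y) -> V (p x y, q x y)) ->
  smooth_on U (fun x y => f (p x y) (q x y)).
Proof. intros HU HV Hf Hp Hq H k. now apply Ck_on_comp with V. Qed.

Lemma open_fst_neq0 : open (fun p : R * R => fst p <> 0).
Proof.
apply locally_2d_open. intros x y H. simpl in H.
apply (continuity_2d_pt_neq_0 (fun u _ => u) x y); auto. apply continuity_2d_pt_id1.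
Qed.

Lemma open_fst_gt0 : open (fun p : R * R => 0 < fst p).
Proof.
apply locally_2d_open. intros x y H. simpl in H. exists (mkposreal x H). simpl.
intros u v Hu _. apply Rabs_def2 in Hu. lra.
Qed.

Lemma smooth_on_inv U f : open U -> smooth_on U f ->
  (forall x y, U (x, y) -> f x y <> 0) -> smooth_on U (fun x y => / f x y).
Proof.
intros HU Hf H.
apply (smooth_on_comp U (fun p => fst p <> 0) (fun u _ => / u) f (fun _ y => y)); auto.
3: now apply smooth_on_snd.
exact open_fst_neq0.
intros k. induction k as [|k IH].
- split; [|trivial]. intros x y Hx.
  apply (continuity_2d_pt_inv (fun u _ => u)); auto. apply continuity_2d_pt_id1.
(* The derivative of the reciprocal is a polynomial in the reciprocal, so the induction hypothesis
   and the product rule close the step. *)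
- apply Ck_on_intro with (fun u _ => -1 * (/ u * / u)) (fun _ _ => 0);
    try exact open_fst_neq0.
  + intros x y Hx. simpl in Hx. apply differentiable_pt_lim_proj1_0.
    apply is_derive_Reals. auto_derive; auto. field; auto.
  + apply Ck_on_mult; try exact open_fst_neq0.
    * apply Ck_on_const, open_fst_neq0.
    * apply Ck_on_mult; auto; exact open_fst_neq0.
  + apply Ck_on_const, open_fst_neq0.
Qed.

Lemma smooth_on_div U f g : open U -> smooth_on U f -> smooth_on U g ->
  (forall x y, U (x, y) -> g x y <> 0) -> smooth_on U (fun x y => f x y / g x y).
Proof. intros. apply smooth_on_mult; auto. now apply smooth_on_inv. Qed.

Lemma smooth_on_Rpower U f a : open U -> smooth_on U f ->
  (forall x y, U (x, y) -> 0 < f x y) -> smooth_on U (fun x y => Rpower (f x y) a).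
Proof.
intros HU Hf H.
apply (smooth_on_comp U (fun p => 0 < fst p) (fun u _ => Rpower u a) f (fun _ y => y)); auto.
3: now apply smooth_on_snd.
exact open_fst_gt0.
assert (Hd : forall a x y, 0 < x ->
  differentiable_pt_lim (fun u _ => Rpower u a) x y (a * Rpower x (a - 1)) 0).
{ intros b x y Hx. apply differentiable_pt_lim_proj1_0. now apply derivable_pt_lim_power. }
(* Differentiation lowers the exponent by one, so the induction has to range over all exponents. *)
intros k. revert a. induction k as [|k IH]; intros a.
- split; [|trivial]. intros x y Hx. apply differentiable_continuity_pt.
  eexists; eexists. now apply Hd.
- apply Ck_on_intro with (fun u _ => a * Rpower u (a - 1)) (fun _ _ => 0);
    try exact open_fst_gt0.
  + intros x y Hx. now apply Hd.
  + apply Ck_on_mult; auto; try exact open_fst_gt0. apply Ck_on_const, open_fst_gt0.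
  + apply Ck_on_const, open_fst_gt0.
Qed.

Lemma smooth_on_continuity U f x y : smooth_on U f -> U (x, y) -> continuity_2d_pt f x y.
Proof. intros H. apply (Ck_on_continuity 0), H. Qed.

Lemma smooth_on_differentiable U f x y : open U -> smooth_on U f -> U (x, y) ->
  differentiable_pt_lim f x y (dx f x y) (dy f x y).
Proof. intros HU H. now apply (Ck_on_differentiable 0). Qed.

Lemma smooth_on_is_derive_x U f x y : smooth_on U f -> U (x, y) ->
  is_derive (fun t => f t y) x (dx f x y).
Proof. intros H Hxy. destruct (H 1%nat) as [_ [He _]]. apply Derive_correct, (He x y Hxy). Qed.

Lemma smooth_on_is_derive_y U f x y : smooth_on U f -> U (x, y) ->
  is_derive (fun t => f x t) y (dy f x y).
Proof. intros H Hxy. destruct (H 1%nat) as [_ [He _]]. apply Derive_correct, (He x y Hxy). Qed.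

Lemma dx_dy_comm U f x y : open U -> smooth_on U f -> U (x, y) ->
  dx (dy f) x y = dy (dx f) x y.
Proof.
intros HU Hf Hxy. pose proof (smooth_on_dx _ _ Hf) as Hx. pose proof (smooth_on_dy _ _ Hf) as Hy.
apply Schwarz.
- generalize (open_locally_2d U x y HU Hxy). apply locally_2d_imp. intros u v Huv.
  repeat split.
  + exists (dx f u v). now apply (smooth_on_is_derive_x U).
  + exists (dy f u v). now apply (smooth_on_is_derive_y U).
  + exists (dx (dy f) u v). now apply (smooth_on_is_derive_x U (dy f)).
  + exists (dy (dx f) u v). now apply (smooth_on_is_derive_y U (dx f)).
- apply (smooth_on_continuity U (dx (dy f))); auto. now apply smooth_on_dx.
- apply (smooth_on_continuity U (dy (dx f))); auto. now apply smooth_on_dy.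
Qed.

Lemma is_derive_graph U f s x ds : open U -> smooth_on U f -> U (x, s x) -> is_derive s x ds ->
  is_derive (fun t => f t (s t)) x (dx f x (s x) + dy f x (s x) * ds).
Proof.
intros HU Hf Hx Hs. apply is_derive_Reals.
replace (_ + _) with (dx f x (s x) * 1 + dy f x (s x) * ds) by ring.
apply (derivable_pt_lim_comp_2d f (fun t => t) s).
- now apply smooth_on_differentiable with U.
- apply derivable_pt_lim_id.
- now apply is_derive_Reals.
Qed.

(** * Nijenhuis torsion and the discriminant *)

Lemma dx_row U f g h k x y :
  smooth_on U f -> smooth_on U g -> smooth_on U h -> smooth_on U k -> U (x, y) ->
  dx (fun x y => f x y * g x y + h x y * k x y) x y =
  dx f x y * g x y + f x y * dx g x y + (dx h x y * k x y + h x y * dx k x y).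
Proof.
intros Hf Hg Hh Hk Hxy. apply is_derive_unique.
pose proof (smooth_on_is_derive_x _ _ _ _ Hf Hxy). pose proof (smooth_on_is_derive_x _ _ _ _ Hg Hxy).
pose proof (smooth_on_is_derive_x _ _ _ _ Hh Hxy). pose proof (smooth_on_is_derive_x _ _ _ _ Hk Hxy).
apply (is_derive_plus (fun t => f t y * g t y) (fun t => h t y * k t y)).
- apply (is_derive_mult (fun t => f t y) (fun t => g t y)); auto. intros; apply Rmult_comm.
- apply (is_derive_mult (fun t => h t y) (fun t => k t y)); auto. intros; apply Rmult_comm.
Qed.

Lemma dy_row U f g h k x y :
  smooth_on U f -> smooth_on U g -> smooth_on U h -> smooth_on U k -> U (x, y) ->
  dy (fun x y => f x y * g x y + h x y * k x y) x y =
  dy f x y * g x y + f x y * dy g x y + (dy h x y * k x y + h x y * dy k x y).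
Proof.
intros Hf Hg Hh Hk Hxy. apply is_derive_unique.
pose proof (smooth_on_is_derive_y _ _ _ _ Hf Hxy). pose proof (smooth_on_is_derive_y _ _ _ _ Hg Hxy).
pose proof (smooth_on_is_derive_y _ _ _ _ Hh Hxy). pose proof (smooth_on_is_derive_y _ _ _ _ Hk Hxy).
apply (is_derive_plus (fun t => f x t * g x t) (fun t => h x t * k x t)).
- apply (is_derive_mult (fun t => f x t) (fun t => g x t)); auto. intros; apply Rmult_comm.
- apply (is_derive_mult (fun t => h x t) (fun t => k x t)); auto. intros; apply Rmult_comm.
Qed.

(** All derivatives of [v] and [u] cancel: the torsion is bilinear over functions and skew, so in
    dimension two it is the determinant [w] of the pair times its value on the coordinate frame. *)
Lemma torsion_tensorial U L v u x y :
  smooth_operator_on U L -> smooth_vfield_on U v -> smooth_vfield_on U u -> U (x, y) ->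
  let w := vf1 v x y * vf2 u x y - vf2 v x y * vf1 u x y in
  vf1 (torsion L v u) x y =
    w * (op21 L x y * dy (op12 L) x y + op12 L x y * dy (op21 L) x y
         - op12 L x y * (dx (op11 L) x y + dx (op22 L) x y)
         + (op11 L x y - op22 L x y) * dy (op11 L) x y) /\
  vf2 (torsion L v u) x y =
    w * ((op11 L x y - op22 L x y) * dx (op22 L) x y
         + op21 L x y * (dy (op11 L) x y + dy (op22 L) x y)
         - op12 L x y * dx (op21 L) x y - op21 L x y * dx (op12 L) x y).
Proof.
intros [Ha [Hb [Hc Hd]]] [Hv1 Hv2] [Hu1 Hu2] Hxy w. unfold w.
unfold torsion, vsub, vadd, bracket, act, deriv_along; cbv beta iota delta [vf1 vf2].
fold (vf1 v) (vf2 v) (vf1 u) (vf2 u).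
rewrite !(dx_row U), !(dy_row U) by assumption.
split; ring.
Qed.

(** Split off [x / 2] times the identity: the traceless part has first row [(p, op12)], and the
    discriminant becomes [p ^ 2 + op12 * op21]. The quadratic terms of the torsion are the
    derivatives of this expression up to sign, and the terms containing the derivatives of the trace
    reduce to the entries [op12] and [p], since [tr L = x]. The same expression shows that [g]
    inherits smoothness from [L]. *)
Lemma nijenhuis_discriminant_equations U g L :
  open U -> smooth_operator_on U L ->
  (forall x y, U (x, y) -> op_tr L x y = x /\ (op_tr L x y / 2) ^ 2 - op_det L x y = g x y) ->
  smooth_on U g /\
  (nijenhuis_on U L <-> forall x y, U (x, y) ->
     op11 L x y = x / 2 + dx g x y /\ op12 L x y = dy g x y).
Proof.
intros HU HL Htd. destruct (HL) as [Ha [Hb [Hc Hd]]].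
set (p := fun x y => op11 L x y - x / 2).
assert (Hp : smooth_on U p).
{ apply smooth_on_minus; auto. apply smooth_on_mult; auto using smooth_on_fst, smooth_on_const. }
assert (Hgp : forall x y, U (x, y) ->
  p x y * p x y + op12 L x y * op21 L x y = g x y).
{ intros x y Hxy. destruct (Htd x y Hxy) as [Ht Hg].
  rewrite <- Hg, Ht. unfold op_det. unfold op_tr in Ht.
  replace (op22 L x y) with (x - op11 L x y) by lra. unfold p. field. }
assert (Hg : smooth_on U g).
{ apply smooth_on_ext with (2 := Hgp); auto.
  apply smooth_on_plus; auto; now apply smooth_on_mult. }
split; [exact Hg|].
assert (Ea : forall x y, U (x, y) -> op11 L x y = x / 2 + p x y) by (intros; unfold p; ring).
assert (Ed : forall x y, U (x, y) -> op22 L x y = x / 2 + - p x y).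
{ intros x y Hxy. destruct (Htd x y Hxy) as [Ht _]. unfold op_tr in Ht. unfold p. lra. }
assert (Dg : forall x y, U (x, y) ->
  dx g x y = dx p x y * p x y + p x y * dx p x y
    + (dx (op12 L) x y * op21 L x y + op12 L x y * dx (op21 L) x y) /\
  dy g x y = dy p x y * p x y + p x y * dy p x y
    + (dy (op12 L) x y * op21 L x y + op12 L x y * dy (op21 L) x y)).
{ intros x y Hxy. rewrite <- (dx_row U), <- (dy_row U) by assumption.
  split; [apply (dx_ext_on U) | apply (dy_ext_on U)]; auto; intros; symmetry; auto. }
assert (D : forall x y, U (x, y) ->
  dx (op11 L) x y = / 2 + dx p x y /\ dx (op22 L) x y = / 2 - dx p x y /\
  dy (op11 L) x y = dy p x y /\ dy (op22 L) x y = - dy p x y).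
{ intros x y Hxy.
  rewrite (dx_ext_on U _ _ HU Ea x y Hxy), (dx_ext_on U _ _ HU Ed x y Hxy),
    (dy_ext_on U _ _ HU Ea x y Hxy), (dy_ext_on U _ _ HU Ed x y Hxy).
  pose proof (smooth_on_is_derive_x _ _ _ _ Hp Hxy) as Hpx.
  pose proof (smooth_on_is_derive_y _ _ _ _ Hp Hxy) as Hpy.
  repeat split; apply is_derive_unique; auto_derive;
    try (repeat split; try (eexists; eassumption)); unfold dx, dy; field. }
assert (Htor : forall v u, smooth_vfield_on U v -> smooth_vfield_on U u ->
  forall x y, U (x, y) ->
  let w := vf1 v x y * vf2 u x y - vf2 v x y * vf1 u x y in
  vf1 (torsion L v u) x y = w * (dy g x y - op12 L x y) /\
  vf2 (torsion L v u) x y = w * (op11 L x y - x / 2 - dx g x y)).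
{ intros v u Hv Hu x y Hxy w. subst w.
  destruct (torsion_tensorial U L v u x y HL Hv Hu Hxy) as [-> ->].
  destruct (Dg x y Hxy) as [-> ->]. destruct (D x y Hxy) as [-> [-> [-> ->]]].
  rewrite (Ea x y Hxy), (Ed x y Hxy). split; field. }
split.
- intros HN x y Hxy.
  set (e1 := VField (fun _ _ => 1) (fun _ _ => 0)). set (e2 := VField (fun _ _ => 0) (fun _ _ => 1)).
  assert (He1 : smooth_vfield_on U e1)
    by (split; [apply (smooth_on_const U 1) | apply (smooth_on_const U 0)]; auto).
  assert (He2 : smooth_vfield_on U e2)
    by (split; [apply (smooth_on_const U 0) | apply (smooth_on_const U 1)]; auto).
  destruct (Htor e1 e2 He1 He2 x y Hxy) as [T1 T2].
  destruct (HN e1 e2 He1 He2 x y Hxy) as [N1 N2].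
  rewrite T1 in N1. rewrite T2 in N2. simpl in N1, N2. lra.
- intros E v u Hv Hu x y Hxy. destruct (Htor v u Hv Hu x y Hxy) as [-> ->].
  destruct (E x y Hxy) as [-> ->]. split; ring.
Qed.

(** One parameter covers both cases, [eps = 0] for [L1] and [eps = 1] for [L2]. The discriminant is
    [z ^ 3 + eps ^ 2 * x ^ 2 / 4], so [eps] enters the later arguments only through
    [eps * eps = eps]. *)
Definition normal_form (eps : R) : operator :=
  Operator (fun x z => (1 + eps) * x / 2) (fun x z => 3 * z ^ 2)
           (fun x z => z / 3)             (fun x z => (1 - eps) * x / 2).

(** This is [J^-1 M J] with [M] the matrix [normal_form eps] at [(x, w)] and [J] the Jacobian matrix
    of [(x, y) -> (x, w)], whose rows are [(1, 0)] and [(dx w, dy w)]. *)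
Definition pullback_normal_form (eps : R) (w : R -> R -> R) : operator :=
  Operator (fun x y => (1 + eps) / 2 * x + 3 * w x y ^ 2 * dx w x y)
           (fun x y => 3 * w x y ^ 2 * dy w x y)
           (fun x y => (w x y - 9 * w x y ^ 2 * dx w x y ^ 2 - 3 * eps * x * dx w x y)
                       / (3 * dy w x y))
           (fun x y => (1 - eps) / 2 * x - 3 * w x y ^ 2 * dx w x y).

Definition operators_agree (L M : operator) (x y : R) : Prop :=
  op11 L x y = op11 M x y /\ op12 L x y = op12 M x y /\
  op21 L x y = op21 M x y /\ op22 L x y = op22 M x y.

Lemma second_coordinate_box w : second_coordinate w ->
  exists d, 0 < d /\ smooth_on (box d) w /\ forall x y, box d (x, y) -> dy w x y <> 0.
Proof.
intros [U [HU [Hs Hw]]]. destruct (nbhd0_box U HU) as [d [Hd HdU]].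
exists d. split; [assumption|]. split; [now apply smooth_on_subset with U|auto].
Qed.

Lemma matrix_in_coordinates_normal_form w eps L : second_coordinate w ->
  matrix_in_coordinates w L (normal_form eps) <->
  locally_2d (operators_agree L (pullback_normal_form eps w)) 0 0.
Proof.
intros Hw. destruct (second_coordinate_box w Hw) as [d [Hd [_ Hy]]].
assert (H : locally_2d (fun x y => dy w x y <> 0) 0 0) by (apply locally_2d_box; eauto).
unfold matrix_in_coordinates, operators_agree, act, coord_field1, coord_field2,
  normal_form, pullback_normal_form.
cbv beta iota zeta delta [vf1 vf2 op11 op12 op21 op22].
fold (op11 L) (op12 L) (op21 L) (op22 L).
split; intros HL; generalize (locally_2d_and _ _ _ _ H HL); apply locally_2d_imp;
  intros x y [Hyy E].
- destruct E as [[E1 E2] [E3 E4]].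
  (* The second coordinate field is vertical, so its image determines [op12] and [op22] alone; the
     first column then follows by substitution. *)
  assert (Eb : op12 L x y = 3 * w x y ^ 2 * dy w x y).
  { replace (op12 L x y) with ((op11 L x y * 0 + op12 L x y * / dy w x y) * dy w x y)
      by (field; assumption). rewrite E3. ring. }
  assert (Ed : op22 L x y = (1 - eps) / 2 * x - 3 * w x y ^ 2 * dx w x y).
  { replace (op22 L x y) with ((op21 L x y * 0 + op22 L x y * / dy w x y) * dy w x y)
      by (field; assumption). rewrite E4. field. assumption. }
  rewrite Eb in *. rewrite Ed in *.
  assert (Ea : op11 L x y = (1 + eps) / 2 * x + 3 * w x y ^ 2 * dx w x y).
  { replace (op11 L x y) with (op11 L x y * 1 + 3 * w x y ^ 2 * dy w x y *
      (- dx w x y / dy w x y) + 3 * w x y ^ 2 * dx w x y) by (field; assumption).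
    rewrite E1. field. }
  repeat split; auto.
  replace (op21 L x y) with (op21 L x y * 1 + ((1 - eps) / 2 * x - 3 * w x y ^ 2 * dx w x y)
    * (- dx w x y / dy w x y) + ((1 - eps) / 2 * x - 3 * w x y ^ 2 * dx w x y)
    * (dx w x y / dy w x y)) by (field; assumption).
  rewrite E2. field. assumption.
- destruct E as [-> [-> [-> ->]]]. repeat split; field; assumption.
Qed.

Lemma dx_normal_form w eps x y : ex_derive (fun t => w t y) x ->
  dx (fun x y => w x y ^ 3 + eps * x ^ 2 / 4) x y = 3 * w x y ^ 2 * dx w x y + eps * x / 2.
Proof.
intros H. apply is_derive_unique. auto_derive; [easy|]. unfold dx. field.
Qed.

Lemma dy_normal_form w eps x y : ex_derive (fun t => w x t) y ->
  dy (fun x y => w x y ^ 3 + eps * x ^ 2 / 4) x y = 3 * w x y ^ 2 * dy w x y.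
Proof.
intros H. apply is_derive_unique. auto_derive; [easy|]. unfold dy. field.
Qed.

(* Off the zero set of [w] the entry [op21] is forced by the discriminant; as
   [dy w] does not vanish, that set is nowhere dense and continuity does the rest. *)
Lemma nijenhuis_normal_form g w eps L : eps * eps = eps -> second_coordinate w ->
  locally_2d (fun x y => g x y = w x y ^ 3 + eps * x ^ 2 / 4) 0 0 ->
  (nijenhuis_with_discriminant g L <->
   locally_2d (operators_agree L (pullback_normal_form eps w)) 0 0).
Proof.
intros Heps Hw Hg. destruct (second_coordinate_box w Hw) as [d1 [Hd1 [Hs1 Hy1]]].
destruct (proj1 (locally_2d_box _) Hg) as [d2 [Hd2 Hg2]].
assert (Hgd : forall e, e <= d1 -> e <= d2 -> forall x y, box e (x, y) ->
  dx g x y = 3 * w x y ^ 2 * dx w x y + eps * x / 2 /\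
  dy g x y = 3 * w x y ^ 2 * dy w x y).
{ intros e He1 He2 x y Hxy. pose proof (box_le _ _ _ He1 Hxy) as Hxy1.
  pose proof (box_le _ _ _ He2 Hxy) as Hxy2.
  rewrite (dx_ext_on (box d2) g _ (open_box d2) Hg2 x y Hxy2).
  rewrite (dy_ext_on (box d2) g _ (open_box d2) Hg2 x y Hxy2).
  split; [apply dx_normal_form | apply dy_normal_form]; eexists.
  - apply (smooth_on_is_derive_x (box d1)); auto.
  - apply (smooth_on_is_derive_y (box d1)); auto. }
split.
- intros [U [HU [HL [HN Htd]]]].
  destruct (nijenhuis_discriminant_equations U g L (proj1 HU) HL Htd) as [_ HE].
  pose proof (proj1 HE HN) as E. clear HE HN.
  destruct (nbhd0_box U HU) as [d3 [Hd3 HU3]].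
  set (e := Rmin d1 (Rmin d2 d3)).
  assert (He : 0 < e) by (repeat apply Rmin_pos; assumption).
  assert (Hle : e <= d1 /\ e <= d2 /\ e <= d3).
  { pose proof (Rmin_l d1 (Rmin d2 d3)). pose proof (Rmin_r d1 (Rmin d2 d3)).
    pose proof (Rmin_l d2 d3). pose proof (Rmin_r d2 d3). unfold e. lra. }
  destruct Hle as [He1 [He2 He3]].
  assert (Eall : forall x y, box e (x, y) ->
    op11 L x y = (1 + eps) / 2 * x + 3 * w x y ^ 2 * dx w x y /\
    op12 L x y = 3 * w x y ^ 2 * dy w x y /\
    op22 L x y = (1 - eps) / 2 * x - 3 * w x y ^ 2 * dx w x y).
  { intros x y Hxy. destruct (Hgd e He1 He2 x y Hxy) as [Gx Gy].
    destruct (E x y (HU3 _ (box_le _ _ _ He3 Hxy))) as [Ea Eb].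
    destruct (Htd x y (HU3 _ (box_le _ _ _ He3 Hxy))) as [Ht _]. unfold op_tr in Ht.
    rewrite Gx in Ea. rewrite Gy in Eb. repeat split; lra. }
  set (D := fun x y => op21 L x y * (3 * dy w x y)
    - (w x y - 9 * w x y ^ 2 * dx w x y ^ 2 - 3 * eps * x * dx w x y)).
  assert (HwD : forall x y, box e (x, y) -> w x y <> 0 -> D x y = 0).
  { intros x y Hxy Hw0. destruct (Eall x y Hxy) as [Ea [Eb Ed]].
    destruct (Htd x y (HU3 _ (box_le _ _ _ He3 Hxy))) as [Ht Hdisc].
    rewrite Ht, (Hg2 x y (box_le _ _ _ He2 Hxy)) in Hdisc. unfold op_det in Hdisc.
    rewrite Ea, Eb, Ed in Hdisc. unfold D.
    (* The discriminant of [L] minus the prescribed one equals [w ^ 2 * D], once [eps * eps] is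
       replaced by [eps]. *)
    apply (Rmult_eq_reg_l (w x y ^ 2)); [|now apply pow_nonzero].
    transitivity (((x / 2) ^ 2 - (((1 + eps) / 2 * x + 3 * w x y ^ 2 * dx w x y)
      * ((1 - eps) / 2 * x - 3 * w x y ^ 2 * dx w x y)
      - 3 * w x y ^ 2 * dy w x y * op21 L x y)) - (w x y ^ 3 + eps * eps * x ^ 2 / 4));
      [field|]. rewrite Heps, Hdisc. field. }
  assert (HD : forall x y, box e (x, y) -> D x y = 0).
  { intros x y Hxy. destruct (Req_dec (D x y) 0) as [|HD]; [assumption|exfalso].
    assert (HsD : smooth_on (box e) D).
    { pose proof (open_box e) as Hop.
      assert (Hsw : smooth_on (box e) w).
      { apply smooth_on_subset with (box d1); auto. intros p. now apply box_le. }
      assert (Hsc : smooth_on (box e) (op21 L)).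
      { apply smooth_on_subset with U; [|apply HL]. intros p Hp. apply HU3.
        now apply box_le with e. }
      pose proof (smooth_on_dx _ _ Hsw). pose proof (smooth_on_dy _ _ Hsw).
      repeat (first [ assumption | apply smooth_on_minus | apply smooth_on_mult
        | apply smooth_on_pow | apply smooth_on_const | apply smooth_on_fst ]). }
    pose proof (continuity_2d_pt_neq_0 D x y (smooth_on_continuity _ _ _ _ HsD Hxy) HD) as Hloc.
    apply (Hy1 x y (box_le _ _ _ He1 Hxy)).
    unfold dy. rewrite (Derive_ext_loc _ (fun _ => 0)); [apply Derive_const|].
    apply (locally_2d_1d_y (fun u v => w u v = 0)).
    generalize (locally_2d_and _ _ _ _ Hloc (open_locally_2d _ _ _ (open_box e) Hxy)).
    apply locally_2d_imp. intros u v [H1 H2].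
    destruct (Req_dec (w u v) 0) as [|H3]; [assumption|]. exfalso. auto. }
  apply locally_2d_box. exists e. split; [assumption|]. intros x y Hxy.
  destruct (Eall x y Hxy) as [Ea [Eb Ed]]. repeat split; auto. simpl.
  pose proof (Hy1 x y (box_le _ _ _ He1 Hxy)).
  pose proof (HD x y Hxy) as H0. unfold D in H0. apply Rminus_diag_uniq in H0.
  simpl in H0. rewrite <- H0. field. assumption.
- intros HL. destruct (proj1 (locally_2d_box _) HL) as [d3 [Hd3 HL3]].
  set (e := Rmin d1 (Rmin d2 d3)).
  assert (He : 0 < e) by (repeat apply Rmin_pos; assumption).
  assert (Hle : e <= d1 /\ e <= d2 /\ e <= d3).
  { pose proof (Rmin_l d1 (Rmin d2 d3)). pose proof (Rmin_r d1 (Rmin d2 d3)).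
    pose proof (Rmin_l d2 d3). pose proof (Rmin_r d2 d3). unfold e. lra. }
  destruct Hle as [He1 [He2 He3]].
  pose proof (open_box e) as Hop.
  assert (Hsw : smooth_on (box e) w).
  { apply smooth_on_subset with (box d1); auto. intros p. now apply box_le. }
  pose proof (smooth_on_dx _ _ Hsw). pose proof (smooth_on_dy _ _ Hsw).
  assert (HsL : smooth_operator_on (box e) L).
  { repeat split; eapply smooth_on_ext; try exact Hop.
    1, 3, 5, 7: intros x y Hxy; symmetry; apply (HL3 x y (box_le _ _ _ He3 Hxy)).
    all: simpl.
    3: { apply smooth_on_div; auto.
      3: intros x y Hxy; apply Rmult_integral_contrapositive; split; [lra|];
         apply (Hy1 x y (box_le _ _ _ He1 Hxy)).
      all: repeat (first [ assumption | apply smooth_on_minus | apply smooth_on_mult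
        | apply smooth_on_const | apply smooth_on_fst ]). }
    all: repeat (first [ assumption | apply smooth_on_plus | apply smooth_on_mult
        | apply smooth_on_const | apply smooth_on_fst | apply smooth_on_opp ]). }
  assert (Htd : forall x y, box e (x, y) ->
    op_tr L x y = x /\ (op_tr L x y / 2) ^ 2 - op_det L x y = g x y).
  { intros x y Hxy. unfold op_tr, op_det.
    destruct (HL3 x y (box_le _ _ _ He3 Hxy)) as [-> [-> [-> ->]]].
    rewrite (Hg2 x y (box_le _ _ _ He2 Hxy)). simpl. split; [field|].
    transitivity (w x y ^ 3 + eps * eps * x ^ 2 / 4); [field|now rewrite Heps].
    apply (Hy1 x y (box_le _ _ _ He1 Hxy)). }
  exists (box e). split; [now apply box_nbhd0|]. split; [assumption|]. split; [|assumption].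
  apply (nijenhuis_discriminant_equations (box e) g L Hop HsL Htd).
  intros x y Hxy. destruct (HL3 x y (box_le _ _ _ He3 Hxy)) as [-> [-> _]].
  destruct (Hgd e He1 He2 x y Hxy) as [-> ->]. simpl. split; field.
Qed.

Lemma matrix_in_coordinates_ext w L M N :
  (forall x z, operators_agree M N x z) ->
  matrix_in_coordinates w L M -> matrix_in_coordinates w L N.
Proof.
intros H. apply locally_2d_imp. intros x y. cbv zeta.
destruct (H x (w x y)) as [-> [-> [-> ->]]]. auto.
Qed.

(** * The critical value system *)

Lemma Derive_eq (f : R -> R) (x l : R) : is_derive f x l -> Derive f x = l.
Proof. exact (is_derive_unique f x l). Qed.

Lemma is_derive_continuity_pt (f : R -> R) x l : is_derive f x l -> continuity_pt f x.
Proof.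
intros H. apply continuity_pt_filterlim. apply (ex_derive_continuous f). now exists l.
Qed.

Lemma continuity_pt_near (f : R -> R) x eps : continuity_pt f x -> 0 < eps ->
  exists e, 0 < e /\ forall y, Rabs (y - x) < e -> Rabs (f y - f x) < eps.
Proof.
intros H He. destruct (proj1 (continuity_pt_locally f x) H (mkposreal eps He)) as [e H'].
exists e. split; [apply cond_pos|exact H'].
Qed.

Lemma is_derive_local_max (f : R -> R) a b c l : is_derive f c l -> a < c < b ->
  (forall x, a < x < b -> f x <= f c) -> l = 0.
Proof.
intros Hl Hc H. apply is_derive_Reals in Hl.
apply (deriv_maximum f a b c (exist _ l Hl)); try apply Hc. auto.
Qed.

Lemma is_derive_local_min (f : R -> R) a b c l : is_derive f c l -> a < c < b ->
  (forall x, a < x < b -> f c <= f x) -> l = 0.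
Proof.
intros Hl Hc H.
assert (- l = 0); [|lra].
apply (is_derive_local_max (fun x => - f x) a b c); auto.
- now apply (is_derive_opp f).
- intros x Hx. apply Ropp_le_contravar. auto.
Qed.

(** * Functions bounded by the fourth power of their derivative *)

Section Glaeser.

(** Here [f1] and [f2] are the first two derivatives of [f]. [Hquartic] makes every critical point a
    zero, which excludes nonzero interior extrema. [Hsmall] is calibrated for the final
    contradiction: with Glaeser's inequality [f1 ^ 2 <= 2 M f] a positive value would satisfy
    [f <= C f1 ^ 4 <= 4 M ^ 2 C f ^ 2 < f]. *)
Variables (d C M : R) (f f1 f2 : R -> R).
Hypotheses
  (Hf : forall x, Rabs x < d -> is_derive f x (f1 x))
  (Hf1 : forall x, Rabs x < d -> is_derive f1 x (f2 x))
  (Hf2 : forall x, Rabs x < d -> f2 x <= M)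
  (Hquartic : forall x, Rabs x < d -> Rabs (f x) <= C * f1 x ^ 4)
  (Hsmall : forall x, Rabs x < d -> 4 * M ^ 2 * C * Rabs (f x) < 1)
  (f_0 : f 0 = 0) (f1_0 : f1 0 = 0) (HM : 0 <= M) (HC : 0 <= C).

Lemma critical_zero x : Rabs x < d -> f1 x = 0 -> f x = 0.
Proof.
intros Hx H1. pose proof (Hquartic x Hx) as H. rewrite H1 in H.
replace (C * 0 ^ 4) with 0 in H by ring.
pose proof (Rabs_pos (f x)). destruct (Req_dec (f x) 0) as [|Hn]; [assumption|].
apply Rabs_pos_lt in Hn. lra.
Qed.

(** The maximum over [[0, x]] is positive, so it is not at [0]; at an interior point it would be
    critical, hence zero. It is therefore attained at [x]. *)
Lemma positive_dominates x y : 0 < x < d -> 0 < f x -> 0 <= y <= x -> f y <= f x.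
Proof.
intros Hx Hfx Hy.
destruct (continuity_ab_maj f 0 x) as [p [Hp Hpx]]; [lra| |].
{ intros c Hc. apply (is_derive_continuity_pt _ _ (f1 c)), Hf. rewrite Rabs_pos_eq; lra. }
assert (f x <= f p) by (apply Hp; lra).
assert (p <> 0) by (intros ->; lra).
destruct (Req_dec p x) as [->|Hne]; [now apply Hp|exfalso].
assert (Hpd : Rabs p < d) by (rewrite Rabs_pos_eq; lra).
assert (f p = 0); [|lra]. apply critical_zero; auto.
apply (is_derive_local_max f 0 x p); auto; [lra|]. intros z Hz. apply Hp. lra.
Qed.

(** A negative minimum over [[0, x]] would be interior, since [f 0 = 0] and [f x] is positive; being
    critical, it would be zero. *)
Lemma nonneg_before_positive x y : 0 < x < d -> 0 < f x -> 0 <= y <= x -> 0 <= f y.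
Proof.
intros Hx Hfx Hy. destruct (Rle_or_lt 0 (f y)) as [|Hneg]; [assumption|exfalso].
destruct (continuity_ab_min f 0 x) as [p [Hp Hpx]]; [lra| |].
{ intros c Hc. apply (is_derive_continuity_pt _ _ (f1 c)), Hf. rewrite Rabs_pos_eq; lra. }
assert (f p <= f y) by (apply Hp; lra).
assert (p <> 0) by (intros ->; lra). assert (p <> x) by (intros ->; lra).
assert (Hpd : Rabs p < d) by (rewrite Rabs_pos_eq; lra).
assert (f p = 0); [|lra]. apply critical_zero; auto.
apply (is_derive_local_min f 0 x p); auto; [lra|]. intros z Hz. apply Hp. lra.
Qed.

(** A negative derivative at [x] would make [f] larger just to the left of [x], against
    [positive_dominates]. *)
Lemma derivative_nonneg_at_positive x : 0 < x < d -> 0 < f x -> 0 <= f1 x.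
Proof.
intros Hx Hfx. destruct (Rle_or_lt 0 (f1 x)) as [|Hneg]; [assumption|exfalso].
assert (Hxd : Rabs x < d) by (rewrite Rabs_pos_eq; lra).
destruct (continuity_pt_near f1 x (- f1 x)) as [e [He H]]; [|lra|].
{ apply (is_derive_continuity_pt _ _ (f2 x)); auto. }
set (y := Rmax (x / 2) (x - e / 2)).
assert (Hy : 0 < y < x /\ x - e < y).
{ pose proof (Rmax_l (x / 2) (x - e / 2)). pose proof (Rmax_r (x / 2) (x - e / 2)).
  assert (y < x) by (apply Rmax_lub_lt; lra). unfold y in *. lra. }
destruct (MVT_gen f y x f1) as [c [Hc Hmvt]].
- rewrite Rmin_left, Rmax_right by lra. intros z Hz. apply Hf. rewrite Rabs_pos_eq; lra.
- rewrite Rmin_left, Rmax_right by lra. intros z Hz.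
  apply (is_derive_continuity_pt _ _ (f1 z)), Hf. rewrite Rabs_pos_eq; lra.
- rewrite Rmin_left, Rmax_right in Hc by lra.
  pose proof (positive_dominates x y Hx Hfx).
  assert (Hcx : Rabs (c - x) < e) by (rewrite Rabs_left1; lra).
  pose proof (Rabs_def2 _ _ (H c Hcx)). nra.
Qed.

(* Glaeser's inequality [f1 ^ 2 <= 2 M f] for nonnegative [f] contradicts the
   quartic bound unless [f] vanishes. *)
Lemma not_positive x : 0 < x < d -> ~ 0 < f x.
Proof.
intros Hx Hfx.
(* Where [f] is positive the sign of [f1] is known; an interior zero is a minimum of the nonnegative
   [f], so [f1] vanishes there. *)
assert (Hf1pos : forall y, 0 <= y <= x -> 0 <= f1 y).
{ intros y Hy. pose proof (nonneg_before_positive x y Hx Hfx Hy) as [Hpos|Hz].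
  - destruct (Req_dec y 0) as [->|]; [lra|]. apply derivative_nonneg_at_positive; lra.
  - destruct (Req_dec y 0) as [->|]; [lra|]. destruct (Req_dec y x) as [->|]; [lra|].
    right. symmetry. apply (is_derive_local_min f 0 x y); [|lra|].
    + apply Hf. rewrite Rabs_pos_eq; lra.
    + intros z Hz'. rewrite <- Hz. apply (nonneg_before_positive x); lra. }
(* With [f1] nonnegative and [f2 <= M], the function [f1 ^ 2 - 2 M f] has nonpositive derivative on
   [[0, x]] and starts at [0]: Glaeser's inequality by monotonicity. *)
assert (Hd : forall y, Rabs y < d ->
  is_derive (fun t => f1 t ^ 2 - 2 * M * f t) y (2 * f1 y * (f2 y - M))).
{ intros y Hy. pose proof (Hf y Hy) as H0. pose proof (Hf1 y Hy) as H1.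
  auto_derive.
  - repeat split; eexists; eassumption.
  - rewrite (Derive_eq (fun t => f t) y _ H0), (Derive_eq (fun t => f1 t) y _ H1). ring. }
destruct (MVT_gen (fun t => f1 t ^ 2 - 2 * M * f t) 0 x (fun y => 2 * f1 y * (f2 y - M)))
  as [c [Hc Hmvt]].
- rewrite Rmin_left, Rmax_right by lra. intros y Hy. apply Hd. rewrite Rabs_pos_eq; lra.
- rewrite Rmin_left, Rmax_right by lra. intros y Hy. eapply is_derive_continuity_pt.
  apply Hd. rewrite Rabs_pos_eq; lra.
- rewrite Rmin_left, Rmax_right in Hc by lra. rewrite f_0, f1_0 in Hmvt.
  assert (Hcd : Rabs c < d) by (rewrite Rabs_pos_eq; lra).
  pose proof (Hf2 c Hcd). pose proof (Hf1pos c Hc).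
  assert (HG : f1 x ^ 2 <= 2 * M * f x).
  { assert (0 <= 2 * f1 c * (M - f2 c) * x) by (repeat apply Rmult_le_pos; lra). lra. }
  assert (Hxd : Rabs x < d) by (rewrite Rabs_pos_eq; lra).
  pose proof (Hquartic x Hxd) as H1. pose proof (Hsmall x Hxd) as H2.
  rewrite Rabs_pos_eq in H1, H2 by lra.
  assert (f1 x ^ 4 <= (2 * M * f x) ^ 2).
  { replace (f1 x ^ 4) with ((f1 x ^ 2) ^ 2) by ring.
    apply pow_incr. split; [apply pow2_ge_0|assumption]. }
  assert (C * f1 x ^ 4 <= C * (2 * M * f x) ^ 2) by (apply Rmult_le_compat_l; assumption).
  assert (4 * M ^ 2 * C * f x * f x < 1 * f x) by (apply Rmult_lt_compat_r; assumption).
  lra.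
Qed.

End Glaeser.

Lemma quartic_bound_zero d C M f f1 f2 :
  (forall x, Rabs x < d -> is_derive f x (f1 x)) ->
  (forall x, Rabs x < d -> is_derive f1 x (f2 x)) ->
  (forall x, Rabs x < d -> Rabs (f2 x) <= M) ->
  (forall x, Rabs x < d -> Rabs (f x) <= C * f1 x ^ 4) ->
  (forall x, Rabs x < d -> 4 * M ^ 2 * C * Rabs (f x) < 1) ->
  f 0 = 0 -> f1 0 = 0 -> 0 <= M -> 0 <= C ->
  forall x, 0 <= x < d -> f x = 0.
Proof.
intros Hf Hf1 Hf2 Hq Hs H0 H1 HM HC x Hx.
destruct (Req_dec x 0) as [->|Hx0]; [assumption|].
destruct (Rtotal_order (f x) 0) as [Hlt|[Heq|Hgt]]; [exfalso|assumption|exfalso].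
- apply (not_positive d C M (fun t => - f t) (fun t => - f1 t) (fun t => - f2 t)) with x;
    auto; try lra.
  + intros y Hy. apply (is_derive_opp f); auto.
  + intros y Hy. apply (is_derive_opp f1); auto.
  + intros y Hy. apply Rle_trans with (2 := Hf2 y Hy). rewrite <- Rabs_Ropp. apply Rle_abs.
  + intros y Hy. rewrite Rabs_Ropp. replace ((- f1 y) ^ 4) with (f1 y ^ 4) by ring. auto.
  + intros y Hy. rewrite Rabs_Ropp. auto.
- apply (not_positive d C M f f1 f2) with x; auto; try lra.
  intros y Hy. apply Rle_trans with (2 := Hf2 y Hy). apply Rle_abs.
Qed.

(** One-variable functions are viewed as functions of two variables that ignore the second, so that
    the closure lemmas for [smooth_on] serve them too; the [dx] of such a function is convertible to
    [Derive f]. *)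
Definition smooth1 (d : R) (f : R -> R) : Prop := smooth_on (box d) (fun x _ => f x).

Lemma box_axis d x : Rabs x < d -> box d (x, 0).
Proof.
intros H. split; simpl; auto. rewrite Rabs_R0. apply Rle_lt_trans with (2 := H), Rabs_pos.
Qed.

Lemma smooth1_derive d f x : smooth1 d f -> Rabs x < d -> is_derive f x (Derive f x).
Proof. intros H Hx. exact (smooth_on_is_derive_x (box d) _ x 0 H (box_axis d x Hx)). Qed.

Lemma smooth1_Derive d f : smooth1 d f -> smooth1 d (Derive f).
Proof. intros H. exact (smooth_on_dx _ _ H). Qed.

Lemma smooth1_continuity d f x : smooth1 d f -> Rabs x < d -> continuity_pt f x.
Proof. intros H Hx. eapply is_derive_continuity_pt, smooth1_derive; eauto. Qed.

Lemma smooth1_subset d e f : e <= d -> smooth1 d f -> smooth1 e f.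
Proof. intros H. apply smooth_on_subset. intros p. now apply box_le. Qed.

Lemma smooth1_near d f eps : smooth1 d f -> 0 < d -> 0 < eps ->
  exists e, 0 < e <= d /\ forall y, Rabs y < e -> Rabs (f y - f 0) < eps.
Proof.
intros H Hd Heps.
destruct (continuity_pt_near f 0 eps) as [e [He Hf]]; auto.
{ apply (smooth1_continuity d); auto. now rewrite Rabs_R0. }
exists (Rmin e d). split.
- split; [now apply Rmin_pos|apply Rmin_r].
- intros y Hy. apply Hf. rewrite Rminus_0_r. apply Rlt_le_trans with (1 := Hy), Rmin_l.
Qed.

Lemma is_derive_locally_eq d (f g : R -> R) (x lf lg : R) : Rabs x < d ->
  (forall y, Rabs y < d -> f y = g y) -> is_derive f x lf -> is_derive g x lg -> lf = lg.
Proof.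
intros Hx Hfg Hf Hg. rewrite <- (Derive_eq _ _ _ Hf), <- (Derive_eq _ _ _ Hg).
apply Derive_ext_loc.
apply (locally_2d_1d_x (fun u v => f u = g u) x 0).
generalize (open_locally_2d (box d) x 0 (open_box d) (box_axis d x Hx)).
apply locally_2d_imp. intros u v [Hu _]. auto.
Qed.

(* [A] and [B] stand for [g_y] and [g] along the curve [g_yy = 0]. *)
Record critical_value_system (d : R) (A B a b m : R -> R) : Prop := {
  cvs_d : 0 < d;
  cvs_A : smooth1 d A; cvs_B : smooth1 d B;
  cvs_a : smooth1 d a; cvs_b : smooth1 d b; cvs_m : smooth1 d m;
  cvs_mixed : forall x, Rabs x < d -> 2 * Derive A x * Derive B x = A x * m x;
  cvs_energy : forall x, Rabs x < d ->
    Derive B x ^ 2 - B x = A x * (a x * Derive A x ^ 2 + b x * A x);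
  cvs_A0 : A 0 = 0; cvs_B0 : B 0 = 0; cvs_a0 : a 0 <> 0;
  cvs_m0 : Derive A 0 = 0 -> Derive B 0 = 0 -> m 0 = 2 / 3 }.

(** * Vanishing of [A] and the two possible critical values *)

Lemma cvs_energy_derivative d A B a b m : critical_value_system d A B a b m ->
  let K := fun x => a x * Derive A x ^ 2 + b x * A x in
  smooth1 d K /\
  forall x, Rabs x < d ->
    2 * Derive B x * Derive (Derive B) x - Derive B x = Derive A x * K x + A x * Derive K x.
Proof.
intros S K. destruct S as [Hd HA HB Ha Hb Hm _ HE _ _ _ _].
pose proof (open_box d) as Hop.
assert (HK : smooth1 d K).
{ apply smooth_on_plus; auto; apply smooth_on_mult; auto.
  apply (smooth_on_pow _ (fun x _ => Derive A x)); auto. now apply smooth1_Derive. }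
split; [exact HK|]. intros x Hx.
apply (is_derive_locally_eq d (fun x => Derive B x ^ 2 - B x) (fun x => A x * K x) x); auto.
- pose proof (smooth1_derive _ _ _ HB Hx) as H1.
  pose proof (smooth1_derive _ _ _ (smooth1_Derive _ _ HB) Hx) as H2.
  replace (2 * Derive B x * Derive (Derive B) x - Derive B x)
    with (INR 2 * Derive (Derive B) x * Derive B x ^ 1 - Derive B x) by (simpl; ring).
  apply (is_derive_minus (fun t => Derive B t ^ 2) B); auto.
  now apply is_derive_pow.
- apply (is_derive_mult A K); [| |intros; apply Rmult_comm]; eapply smooth1_derive; eauto.
Qed.

(** At [0] the energy equation reduces to [B' ^ 2 = 0], and its derivative to [a * A' ^ 3 = 0]. Only
    after that does [cvs_m0] give the value of [m 0]. *)
Lemma cvs_first_order d A B a b m : critical_value_system d A B a b m ->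
  Derive A 0 = 0 /\ Derive B 0 = 0 /\ m 0 = 2 / 3.
Proof.
intros S. destruct (cvs_energy_derivative _ _ _ _ _ _ S) as [_ HE'].
assert (H0 : Rabs 0 < d) by (rewrite Rabs_R0; apply S).
assert (HB0 : Derive B 0 = 0).
{ pose proof (cvs_energy _ _ _ _ _ _ S 0 H0) as H.
  rewrite (cvs_A0 _ _ _ _ _ _ S), (cvs_B0 _ _ _ _ _ _ S) in H. nra. }
assert (HA0 : Derive A 0 = 0).
{ specialize (HE' 0 H0). cbv beta in HE'.
  rewrite (cvs_A0 _ _ _ _ _ _ S), HB0 in HE'.
  destruct (Req_dec (Derive A 0) 0) as [|Hn]; [assumption|exfalso].
  apply (Rmult_integral_contrapositive_currified (a 0) (Derive A 0 ^ 3)).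
  - apply S.
  - now apply pow_nonzero.
  - lra. }
repeat split; auto. now apply S.
Qed.

(* If [B ''(0) = 1 / 2], then [B' >= 0.45 x], so [x A A' <= A ^ 2] and
   [(A / x) ^ 2] is nonincreasing, while it tends to [A'(0) ^ 2 = 0]. *)
Lemma cvs_zero_nondegenerate d A B a b m : critical_value_system d A B a b m ->
  Derive (Derive B) 0 = 1 / 2 -> exists e, 0 < e <= d /\ forall x, 0 <= x < e -> A x = 0.
Proof.
intros S HB2. destruct (cvs_first_order _ _ _ _ _ _ S) as [HA1 [HB1 Hm0]].
destruct S as [Hd HA HB Ha Hb Hm Hmix _ HA0 HB0 _ _].
(* The tolerances give [m <= 7/10] and [2 B' >= 9/10 * y], hence [y A A' <= 7/9 * A ^ 2]: the growth
   exponent of [A], ideally [2/3], stays below one. *)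
destruct (smooth1_near d m (1 / 100)) as [e1 [He1 Hm1]]; auto; [lra|].
destruct (smooth1_near d (Derive (Derive B)) (5 / 100)) as [e2 [He2 HB2']]; auto; [|lra|].
{ now apply smooth1_Derive, smooth1_Derive. }
exists (Rmin e1 e2).
assert (Hle : 0 < Rmin e1 e2 <= d /\ Rmin e1 e2 <= e1 /\ Rmin e1 e2 <= e2).
{ pose proof (Rmin_l e1 e2). pose proof (Rmin_r e1 e2).
  assert (0 < Rmin e1 e2) by (apply Rmin_pos; lra). lra. }
set (e := Rmin e1 e2) in *. split; [lra|]. intros x Hx.
destruct (Req_dec (A x) 0) as [|HAx]; [assumption|exfalso].
assert (Hx0 : 0 < x). { destruct (Req_dec x 0) as [->|]; [contradiction|lra]. }
assert (HB1' : forall y, 0 < y <= x -> 9 / 20 * y <= Derive B y).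
{ intros y Hy. destruct (MVT_gen (Derive B) 0 y (Derive (Derive B))) as [c [Hc Hmvt]].
  - rewrite Rmin_left, Rmax_right by lra. intros z Hz.
    apply (smooth1_derive d); [now apply smooth1_Derive|rewrite Rabs_pos_eq; lra].
  - rewrite Rmin_left, Rmax_right by lra. intros z Hz.
    apply (smooth1_continuity d); [now apply smooth1_Derive|rewrite Rabs_pos_eq; lra].
  - rewrite Rmin_left, Rmax_right in Hc by lra. rewrite HB1 in Hmvt.
    assert (Hce : Rabs c < e2) by (rewrite Rabs_pos_eq; lra).
    pose proof (Rabs_def2 _ _ (HB2' c Hce)). rewrite HB2 in H. nra. }
assert (HAA : forall y, 0 < y <= x -> y * (A y * Derive A y) <= A y ^ 2).
{ intros y Hy. pose proof (HB1' y Hy) as H1.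
  assert (Hyd : Rabs y < d) by (rewrite Rabs_pos_eq; lra).
  assert (Hye : Rabs y < e1) by (rewrite Rabs_pos_eq; lra).
  pose proof (Rabs_def2 _ _ (Hm1 y Hye)) as H2. rewrite Hm0 in H2.
  assert (H3 : 2 * Derive B y * (A y * Derive A y) = A y ^ 2 * m y).
  { replace (A y ^ 2 * m y) with (A y * (A y * m y)) by ring. rewrite <- Hmix by assumption. ring. }
  pose proof (pow2_ge_0 (A y)) as H4.
  (* The sign of [A A'] is needed before [2 B'] can be replaced by its lower bound in [H3]. *)
  assert (H5 : 0 <= A y * Derive A y).
  { apply (Rmult_le_reg_l (2 * Derive B y)); [lra|]. rewrite H3, Rmult_0_r.
    apply Rmult_le_pos; lra. }
  assert (9 / 10 * y * (A y * Derive A y) <= 2 * Derive B y * (A y * Derive A y))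
    by (apply Rmult_le_compat_r; lra).
  assert (A y ^ 2 * m y <= A y ^ 2 * (7 / 10)) by (apply Rmult_le_compat_l; lra).
  lra. }
assert (HV : forall y, 0 < y < x -> (A x / x) ^ 2 <= (A y / y) ^ 2).
{ intros y Hy.
  set (dV := fun z => 2 * (z * (A z * Derive A z) - A z ^ 2) / z ^ 3).
  assert (HdV : forall z, y <= z <= x -> is_derive (fun t => (A t / t) ^ 2) z (dV z)).
  { intros z Hz. assert (Hzd : Rabs z < d) by (rewrite Rabs_pos_eq; lra).
    pose proof (smooth1_derive _ _ _ HA Hzd) as H1. auto_derive.
    - split; [eexists; eassumption|]. split; [lra|auto].
    - rewrite (Derive_eq (fun t => A t) z _ H1). unfold dV. field. lra. }
  destruct (MVT_gen (fun t => (A t / t) ^ 2) y x dV) as [c [Hc Hmvt]].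
  - rewrite Rmin_left, Rmax_right by lra. intros z Hz. apply HdV. lra.
  - rewrite Rmin_left, Rmax_right by lra. intros z Hz.
    eapply is_derive_continuity_pt, HdV. lra.
  - rewrite Rmin_left, Rmax_right in Hc by lra.
    assert (H1 : dV c <= 0).
    { unfold dV. assert (Hc0 : 0 < c <= x) by lra. pose proof (HAA c Hc0).
      assert (0 < / c ^ 3) by (apply Rinv_0_lt_compat, pow_lt; lra). unfold Rdiv.
      rewrite <- (Ropp_involutive (2 * _ * _)). apply Rge_le, Ropp_0_le_ge_contravar.
      replace (- (2 * (c * (A c * Derive A c) - A c ^ 2) * / c ^ 3))
        with (2 * (A c ^ 2 - c * (A c * Derive A c)) * / c ^ 3) by ring.
      apply Rmult_le_pos; lra. }
    assert (dV c * (x - y) <= 0); [|lra].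
    assert (0 <= (- dV c) * (x - y)) by (apply Rmult_le_pos; lra). lra. }
assert (Heta : 0 < Rabs (A x / x)).
{ apply Rabs_pos_lt. unfold Rdiv. apply Rmult_integral_contrapositive. split; auto.
  apply Rinv_neq_0_compat. lra. }
(* By the mean value theorem [A y / y] is a value of [A'] near [0], so for small [y] it is less than
   [A x / x] in absolute value, against [HV]. *)
destruct (smooth1_near d (Derive A) (Rabs (A x / x))) as [e3 [He3 HA1']]; auto.
{ now apply smooth1_Derive. }
set (y := Rmin (x / 2) (e3 / 2)).
assert (Hy : 0 < y < x /\ y < e3).
{ pose proof (Rmin_l (x / 2) (e3 / 2)). pose proof (Rmin_r (x / 2) (e3 / 2)).
  assert (0 < y) by (apply Rmin_pos; lra). unfold y in *. lra. }
destruct (MVT_gen A 0 y (Derive A)) as [c [Hc Hmvt]].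
- rewrite Rmin_left, Rmax_right by lra. intros z Hz.
  apply (smooth1_derive d); auto. rewrite Rabs_pos_eq; lra.
- rewrite Rmin_left, Rmax_right by lra. intros z Hz.
  apply (smooth1_continuity d); auto. rewrite Rabs_pos_eq; lra.
- rewrite Rmin_left, Rmax_right in Hc by lra. rewrite HA0 in Hmvt.
  assert (Hce : Rabs c < e3) by (rewrite Rabs_pos_eq; lra).
  pose proof (HA1' c Hce) as H1. rewrite HA1, Rminus_0_r in H1.
  replace (Derive A c) with (A y / y) in H1.
  2: { replace (A y) with (Derive A c * y) by lra. field. lra. }
  destruct Hy as [Hy _]. pose proof (HV y Hy) as H2.
  rewrite <- (pow2_abs (A x / x)), <- (pow2_abs (A y / y)) in H2.
  pose proof (Rabs_pos (A y / y)). nra.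
Qed.

(* If [B ''(0) <> 1 / 2], the differentiated energy equation divided by [A = 2 A' B' / m]
   gives [B' T = a A' ^ 3] with [T] nonzero near [0], hence [|A| <= C A' ^ 4]. *)
Lemma cvs_zero_degenerate d A B a b m : critical_value_system d A B a b m ->
  Derive (Derive B) 0 <> 1 / 2 -> exists e, 0 < e <= d /\ forall x, 0 <= x < e -> A x = 0.
Proof.
intros S HB2. destruct (cvs_first_order _ _ _ _ _ _ S) as [HA1 [HB1 Hm0]].
destruct (cvs_energy_derivative _ _ _ _ _ _ S) as [HK HE'].
set (K := fun x => a x * Derive A x ^ 2 + b x * A x) in HK, HE'.
destruct S as [Hd HA HB Ha Hb Hm Hmix HE HA0 HB0 Ha0 _].
destruct (smooth1_near d m (1 / 6)) as [e1 [He1 Hm1]]; auto; [lra|].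
assert (Hmpos : forall x, Rabs x < e1 -> 1 / 2 < m x).
{ intros x Hx. pose proof (Rabs_def2 _ _ (Hm1 x Hx)). rewrite Hm0 in H. lra. }
(* Both occurrences of the factor [A] in [A' b A + A K'] are replaced by [2 A' B' / m]; collecting
   the multiples of [B'] leaves [T]. Since [A'(0) = 0], its value at [0] is [2 B''(0) - 1]. *)
set (T := fun x => 2 * Derive (Derive B) x - 1 - 2 * Derive A x * Derive K x / m x
                   - 2 * b x * Derive A x ^ 2 / m x).
assert (HT : smooth1 e1 T).
{ pose proof (open_box e1) as Hop. destruct He1 as [_ He1].
  pose proof (smooth1_subset _ _ _ He1 (smooth1_Derive _ _ HA)) as H1.
  pose proof (smooth1_subset _ _ _ He1 (smooth1_Derive _ _ HK)) as H2.
  pose proof (smooth1_subset _ _ _ He1 (smooth1_Derive _ _ (smooth1_Derive _ _ HB))) as H3.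
  pose proof (smooth1_subset _ _ _ He1 Hb) as H4.
  pose proof (smooth1_subset _ _ _ He1 Hm) as H5.
  assert (H6 : forall x y, box e1 (x, y) -> m x <> 0).
  { intros x y [Hx _]. simpl in Hx. pose proof (Hmpos x Hx). lra. }
  unfold smooth1, T in *.
  repeat (first [ assumption | apply smooth_on_minus | apply smooth_on_div
    | apply smooth_on_mult | apply (smooth_on_pow _ (fun x _ => Derive A x))
    | apply smooth_on_const ]). }
assert (HT0 : T 0 <> 0). { unfold T. rewrite HA1. lra. }
assert (HBT : forall x, Rabs x < e1 -> Derive B x * T x = a x * Derive A x ^ 3).
{ intros x Hx. pose proof (Hmpos x Hx) as Hmx.
  assert (Hxd : Rabs x < d) by lra.
  assert (HAx : 2 * Derive A x * Derive B x / m x = A x).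
  { rewrite Hmix by assumption. field. lra. }
  transitivity (2 * Derive B x * Derive (Derive B) x - Derive B x
    - (2 * Derive A x * Derive B x / m x) * Derive K x
    - b x * Derive A x * (2 * Derive A x * Derive B x / m x)).
  - unfold T. field. lra.
  - rewrite HAx, HE' by assumption. ring. }
assert (Htau : 0 < Rabs (T 0) / 2) by (apply Rabs_pos_lt in HT0; lra).
set (tau := Rabs (T 0) / 2) in *.
destruct (smooth1_near e1 T tau) as [e2 [He2 HT2]]; auto; [lra|].
destruct (smooth1_near d a 1) as [e3 [He3 Ha3]]; auto; [lra|].
destruct (smooth1_near d (Derive (Derive A)) 1) as [e4 [He4 HA4]]; auto; [|lra|].
{ now apply smooth1_Derive, smooth1_Derive. }
set (M := Rabs (Derive (Derive A) 0) + 1).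
set (al := Rabs (a 0) + 1).
(* The factor [4] comes from [A = 2 A' B' / m] with [m > 1/2], and [al / tau] from the bound on [B']
   obtained by dividing [a A' ^ 3] by [T]. *)
set (C := 4 * al / tau).
assert (Hal : 0 < al) by (pose proof (Rabs_pos (a 0)); unfold al; lra).
assert (HM : 0 < M) by (pose proof (Rabs_pos (Derive (Derive A) 0)); unfold M; lra).
assert (HC : 0 < C) by (unfold C; apply Rdiv_lt_0_compat; lra).
assert (HMC : 0 < 4 * M ^ 2 * C).
{ apply Rmult_lt_0_compat; auto. apply Rmult_lt_0_compat; [lra|]. now apply pow_lt. }
destruct (smooth1_near d A (/ (4 * M ^ 2 * C))) as [e5 [He5 HA5]]; auto.
{ now apply Rinv_0_lt_compat. }
set (e := Rmin e2 (Rmin e3 (Rmin e4 e5))).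
assert (He : 0 < e <= d /\ e <= e2 /\ e <= e3 /\ e <= e4 /\ e <= e5).
{ pose proof (Rmin_l e2 (Rmin e3 (Rmin e4 e5))). pose proof (Rmin_r e2 (Rmin e3 (Rmin e4 e5))).
  pose proof (Rmin_l e3 (Rmin e4 e5)). pose proof (Rmin_r e3 (Rmin e4 e5)).
  pose proof (Rmin_l e4 e5). pose proof (Rmin_r e4 e5).
  assert (0 < e) by (repeat apply Rmin_pos; lra). unfold e in *. lra. }
exists e. split; [lra|].
apply (quartic_bound_zero e C M A (Derive A) (Derive (Derive A))); auto; try lra.
- intros x Hx. apply (smooth1_derive d); auto. lra.
- intros x Hx. apply (smooth1_derive d); [now apply smooth1_Derive|lra].
- intros x Hx. assert (Hx4 : Rabs x < e4) by lra. pose proof (HA4 x Hx4) as H1.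
  pose proof (Rabs_triang_inv (Derive (Derive A) x) (Derive (Derive A) 0)). unfold M. lra.
- intros x Hx.
  assert (Hx1 : Rabs x < e1) by lra. assert (Hx2 : Rabs x < e2) by lra.
  assert (Hx3 : Rabs x < e3) by lra. assert (Hxd : Rabs x < d) by lra.
  pose proof (Hmpos x Hx1) as Hmx.
  assert (HTx : tau <= Rabs (T x)).
  { pose proof (HT2 x Hx2) as H1. pose proof (Rabs_triang_inv (T 0) (T x)) as H2.
    rewrite Rabs_minus_sym in H1. unfold tau in *. lra. }
  assert (Hax : Rabs (a x) <= al).
  { pose proof (Ha3 x Hx3). pose proof (Rabs_triang_inv (a x) (a 0)). unfold al. lra. }
  assert (H1 : Rabs (Derive B x) * tau <= al * Rabs (Derive A x) ^ 3).
  { apply Rle_trans with (Rabs (Derive B x) * Rabs (T x)).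
    - apply Rmult_le_compat_l; auto. apply Rabs_pos.
    - rewrite <- Rabs_mult, HBT, Rabs_mult, <- RPow_abs by assumption.
      apply Rmult_le_compat_r; auto. apply pow_le, Rabs_pos. }
  assert (H2 : Rabs (A x) <= 4 * Rabs (Derive A x) * Rabs (Derive B x)).
  { assert (H3 : Rabs (A x) * Rabs (m x) = 2 * Rabs (Derive A x) * Rabs (Derive B x)).
    { rewrite <- Rabs_mult, <- Hmix, !Rabs_mult, (Rabs_pos_eq 2) by (assumption || lra). ring. }
    rewrite (Rabs_pos_eq (m x)) in H3 by lra.
    assert (Rabs (A x) * (1 / 2) <= Rabs (A x) * m x)
      by (apply Rmult_le_compat_l; [apply Rabs_pos|lra]).
    lra. }
  apply Rle_trans with (1 := H2).
  assert (H3 : Rabs (Derive B x) <= al / tau * Rabs (Derive A x) ^ 3).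
  { apply (Rmult_le_reg_r tau); auto. apply Rle_trans with (1 := H1). right. field. lra. }
  apply Rle_trans with (4 * Rabs (Derive A x) * (al / tau * Rabs (Derive A x) ^ 3)).
  { apply Rmult_le_compat_l; auto. apply Rmult_le_pos; [lra|apply Rabs_pos]. }
  right. replace (Derive A x ^ 4) with (Rabs (Derive A x) ^ 4).
  { unfold C. field. lra. }
  rewrite RPow_abs. apply Rabs_pos_eq. replace (Derive A x ^ 4) with ((Derive A x ^ 2) ^ 2) by ring.
  apply pow2_ge_0.
- intros x Hx. assert (Hx5 : Rabs x < e5) by lra. pose proof (HA5 x Hx5) as H1.
  rewrite HA0, Rminus_0_r in H1.
  apply (Rmult_lt_compat_l _ _ _ HMC) in H1. rewrite Rinv_r in H1 by lra. exact H1.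
Qed.

Lemma smooth1_reflect d f : smooth1 d f -> smooth1 d (fun x => f (- x)).
Proof.
intros H. pose proof (open_box d) as Hop.
apply (smooth_on_comp (box d) (box d) (fun x _ => f x) (fun x _ => - x) (fun _ y => y)); auto.
- apply smooth_on_opp; auto. now apply smooth_on_fst.
- now apply smooth_on_snd.
- intros x y [Hx Hy]. split; simpl in *; auto. now rewrite Rabs_Ropp.
Qed.

Lemma Derive_reflect d f x : smooth1 d f -> Rabs x < d ->
  Derive (fun t => f (- t)) x = - Derive f (- x).
Proof.
intros H Hx. apply Derive_eq.
replace (- Derive f (- x)) with (-1 * Derive f (- x)) by ring.
apply (is_derive_comp f (fun t => - t)).
- apply (smooth1_derive d); auto. now rewrite Rabs_Ropp.
- auto_derive; auto.
Qed.

(** Under [x -> - x] both [A'] and [B'] change sign, and they occur in the equations only in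
    products of even degree; so one half-line is enough. *)
Lemma cvs_reflect d A B a b m : critical_value_system d A B a b m ->
  critical_value_system d (fun x => A (- x)) (fun x => B (- x)) (fun x => a (- x))
    (fun x => b (- x)) (fun x => m (- x)).
Proof.
intros [Hd HA HB Ha Hb Hm Hmix HE HA0 HB0 Ha0 Hm0].
assert (H0 : Rabs 0 < d) by now rewrite Rabs_R0.
split; auto using smooth1_reflect; rewrite ?Ropp_0; auto.
- intros x Hx. rewrite !(Derive_reflect d) by assumption.
  rewrite <- Hmix by now rewrite Rabs_Ropp. ring.
- intros x Hx. rewrite !(Derive_reflect d) by assumption.
  replace ((- Derive B (- x)) ^ 2) with (Derive B (- x) ^ 2) by ring.
  rewrite HE by now rewrite Rabs_Ropp. ring.
- rewrite !(Derive_reflect d), Ropp_0 by assumption. intros H1 H2. apply Hm0; lra.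
Qed.

Lemma cvs_zero_right d A B a b m : critical_value_system d A B a b m ->
  exists e, 0 < e <= d /\ forall x, 0 <= x < e -> A x = 0.
Proof.
intros S. destruct (Req_dec (Derive (Derive B) 0) (1 / 2)) as [H|H].
- now apply (cvs_zero_nondegenerate d A B a b m).
- now apply (cvs_zero_degenerate d A B a b m).
Qed.

Lemma cvs_zero d A B a b m : critical_value_system d A B a b m ->
  exists e, 0 < e <= d /\ forall x, Rabs x < e -> A x = 0.
Proof.
intros S. destruct (cvs_zero_right _ _ _ _ _ _ S) as [e1 [He1 H1]].
destruct (cvs_zero_right _ _ _ _ _ _ (cvs_reflect _ _ _ _ _ _ S)) as [e2 [He2 H2]].
exists (Rmin e1 e2). pose proof (Rmin_l e1 e2). pose proof (Rmin_r e1 e2).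
assert (0 < Rmin e1 e2) by (apply Rmin_pos; lra). split; [lra|].
intros x Hx. apply Rabs_def2 in Hx. destruct (Rle_or_lt 0 x).
- apply H1. lra.
- rewrite <- (Ropp_involutive x). apply H2. lra.
Qed.

(** With [A = 0] the differentiated energy equation is [B' (2 B'' - 1) = 0]. The vanishing factor
    could a priori change from point to point; the continuity of [B''] at [0] selects one. If
    [B''(0) = 1/2], then [B''] stays above [1/4] and [B'] is nonzero off the origin, so [B'' = 1/2]
    throughout; otherwise the second factor is nonzero near [0], and [B'] vanishes. Then
    [B = B' ^ 2] gives the value. *)
Lemma cvs_critical_value d A B a b m : critical_value_system d A B a b m ->
  exists e, 0 < e <= d /\ (forall x, Rabs x < e -> A x = 0) /\
    ((forall x, Rabs x < e -> B x = 0) \/ (forall x, Rabs x < e -> B x = x ^ 2 / 4)).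
Proof.
intros S. destruct (cvs_zero _ _ _ _ _ _ S) as [e1 [He1 HA0]].
destruct (cvs_first_order _ _ _ _ _ _ S) as [_ [HB1 _]].
destruct (cvs_energy_derivative _ _ _ _ _ _ S) as [_ HE'].
assert (HA1 : forall x, Rabs x < e1 -> Derive A x = 0).
{ intros x Hx. apply (is_derive_locally_eq e1 A (fun _ => 0) x); auto.
  - apply (smooth1_derive d); [apply S|lra].
  - apply (is_derive_const 0). }
assert (HB2 : forall x, Rabs x < e1 -> Derive B x * (2 * Derive (Derive B) x - 1) = 0).
{ intros x Hx. transitivity (2 * Derive B x * Derive (Derive B) x - Derive B x); [ring|].
  rewrite HE', HA1, HA0 by lra. ring. }
assert (HBe : forall x, Rabs x < e1 -> B x = Derive B x ^ 2).
{ intros x Hx. assert (Hxd : Rabs x < d) by lra.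
  pose proof (cvs_energy _ _ _ _ _ _ S x Hxd) as H. rewrite HA0 in H by assumption. lra. }
pose proof (cvs_B _ _ _ _ _ _ S) as HB.
pose proof (smooth1_Derive _ _ HB) as HBd. pose proof (smooth1_Derive _ _ HBd) as HBdd.
destruct (Req_dec (Derive (Derive B) 0) (1 / 2)) as [H|H].
- destruct (smooth1_near d (Derive (Derive B)) (1 / 4)) as [e2 [He2 HB2']]; auto; try lra.
  exists (Rmin e1 e2). pose proof (Rmin_l e1 e2). pose proof (Rmin_r e1 e2).
  assert (0 < Rmin e1 e2) by (apply Rmin_pos; lra).
  split; [lra|]. split; [intros; apply HA0; lra|]. right.
  assert (Hmvt : forall x, Rabs x < Rmin e1 e2 ->
    exists c, Rabs c < Rmin e1 e2 /\ Derive B x = Derive (Derive B) c * x).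
  { intros x Hx.
    assert (Hle : forall z, Rmin 0 x <= z <= Rmax 0 x -> Rabs z <= Rabs x).
    { intros z. unfold Rmin, Rmax, Rabs. destruct (Rle_dec 0 x), (Rcase_abs z), (Rcase_abs x); lra. }
    destruct (MVT_gen (Derive B) 0 x (Derive (Derive B))) as [c [Hc Hc']].
    - intros z Hz. apply (smooth1_derive d); auto.
      assert (Hz' : Rmin 0 x <= z <= Rmax 0 x) by lra. pose proof (Hle z Hz'). lra.
    - intros z Hz. apply (smooth1_continuity d); auto. pose proof (Hle z Hz). lra.
    - exists c. pose proof (Hle c Hc). rewrite HB1 in Hc'. split; lra. }
  assert (Hhalf : forall x, Rabs x < Rmin e1 e2 -> Derive (Derive B) x = 1 / 2).
  { intros x Hx. destruct (Req_dec x 0) as [->|Hx0]; [assumption|].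
    destruct (Hmvt x Hx) as [c [Hc Hc']].
    assert (Hc2 : Rabs c < e2) by lra. assert (Hx1 : Rabs x < e1) by lra.
    pose proof (Rabs_def2 _ _ (HB2' c Hc2)) as Hcc. rewrite H in Hcc.
    destruct (Rmult_integral _ _ (HB2 x Hx1)) as [H0'|H0']; [|lra].
    rewrite Hc' in H0'. destruct (Rmult_integral _ _ H0'); lra. }
  intros x Hx. destruct (Hmvt x Hx) as [c [Hc Hc']].
  rewrite HBe, Hc', Hhalf by lra. field.
- assert (Hpos : 0 < Rabs (Derive (Derive B) 0 - 1 / 2)) by (apply Rabs_pos_lt; lra).
  destruct (smooth1_near d (Derive (Derive B)) _ HBdd (cvs_d _ _ _ _ _ _ S) Hpos)
    as [e2 [He2 HB2']].
  exists (Rmin e1 e2). pose proof (Rmin_l e1 e2). pose proof (Rmin_r e1 e2).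
  assert (0 < Rmin e1 e2) by (apply Rmin_pos; lra).
  split; [lra|]. split; [intros; apply HA0; lra|]. left.
  intros x Hx. assert (Hx1 : Rabs x < e1) by lra. assert (Hx2 : Rabs x < e2) by lra.
  rewrite HBe by assumption.
  destruct (Rmult_integral _ _ (HB2 x Hx1)) as [->|H0']; [ring|exfalso].
  pose proof (HB2' x Hx2) as H3. replace (Derive (Derive B) x) with (1 / 2) in H3 by lra.
  rewrite Rabs_minus_sym in H3. lra.
Qed.

(** * Hadamard division *)

(** For [n = 0], applied to [dy f], this is the quotient in Hadamard's lemma. Each derivative in [z]
    brings out a factor [t]; the weight [t ^ n] makes the family closed under both partial
    derivatives, which turns its smoothness into an induction. *)
Definition ray_mean (n : nat) (f : R -> R -> R) (x z : R) : R :=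
  RInt (fun t => t ^ n * f x (t * z)) 0 1.

Lemma box_ray d x z t : box d (x, z) -> 0 <= t <= 1 -> box d (x, t * z).
Proof.
intros [Hx Hz] Ht. split; simpl in *; auto. rewrite Rabs_mult, (Rabs_pos_eq t) by lra.
pose proof (Rabs_pos z). nra.
Qed.

Lemma continuity_2d_pt_pow n x y : continuity_2d_pt (fun _ v => v ^ n) x y.
Proof.
apply (smooth_on_continuity (fun _ => True)); auto.
apply (smooth_on_pow (fun _ => True) (fun _ v => v)); [apply open_true|].
apply smooth_on_snd, open_true.
Qed.

Lemma continuity_ray n f x z t : continuity_2d_pt f x (t * z) ->
  continuity_2d_pt (fun u v => v ^ n * f u (v * z)) x t.
Proof.
intros H. apply continuity_2d_pt_mult; [apply continuity_2d_pt_pow|].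
apply (continuity_2d_pt_comp f (fun u _ => u) (fun _ v => v * z)); auto.
- apply continuity_2d_pt_id1.
- apply continuity_2d_pt_mult; [apply continuity_2d_pt_id2|apply continuity_2d_pt_const].
Qed.

Lemma ex_RInt_ray n d f x z : smooth_on (box d) f -> box d (x, z) ->
  ex_RInt (fun t => t ^ n * f x (t * z)) 0 1.
Proof.
intros Hf Hxz. apply (ex_RInt_continuous (fun t => t ^ n * f x (t * z))).
rewrite Rmin_left, Rmax_right by lra. intros t Ht.
apply continuity_pt_filterlim.
apply (continuity_2d_pt_y (fun u v => v ^ n * f u (v * z)) x t), continuity_ray.
apply (smooth_on_continuity (box d)); auto. now apply box_ray.
Qed.

Lemma continuity_ray_mean n d f x z : smooth_on (box d) f -> box d (x, z) ->
  continuity_2d_pt (ray_mean n f) x z.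
Proof.
intros Hf Hxz eps. pose proof Hxz as [Hx Hz]. simpl in Hx, Hz.
(* Midway between the point and the boundary: the closed square of half-side [r] lies in [box d],
   giving uniform continuity, and is a neighbourhood of [(x, z)]. *)
set (r := (Rmax (Rabs x) (Rabs z) + d) / 2).
assert (Hr : Rabs x < r /\ Rabs z < r /\ r < d).
{ pose proof (Rmax_l (Rabs x) (Rabs z)). pose proof (Rmax_r (Rabs x) (Rabs z)).
  assert (Rmax (Rabs x) (Rabs z) < d) by (apply Rmax_lub_lt; auto). unfold r. lra. }
assert (He2 : 0 < eps / 2) by (pose proof (cond_pos eps); lra).
destruct (uniform_continuity_2d f (- r) r (- r) r) with (eps := mkposreal _ He2)
  as [del Hdel].
{ intros u v Hu Hv. apply (smooth_on_continuity (box d)); auto.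
  split; simpl; apply Rabs_def1; lra. }
simpl in Hdel.
assert (He : 0 < Rmin del (Rmin (r - Rabs x) (r - Rabs z))).
{ apply Rmin_pos; [apply cond_pos|]. apply Rmin_pos; lra. }
exists (mkposreal _ He). simpl. intros u v Hu Hv.
pose proof (Rmin_l del (Rmin (r - Rabs x) (r - Rabs z))).
pose proof (Rmin_r del (Rmin (r - Rabs x) (r - Rabs z))).
pose proof (Rmin_l (r - Rabs x) (r - Rabs z)). pose proof (Rmin_r (r - Rabs x) (r - Rabs z)).
pose proof (Rabs_triang_inv u x). pose proof (Rabs_triang_inv v z).
assert (Hur : Rabs u < r) by lra. assert (Hvr : Rabs v < r) by lra.
assert (Huv : box d (u, v)) by (split; simpl; lra).
unfold ray_mean.
pose proof (ex_RInt_ray n d f u v Hf Huv) as I1. pose proof (ex_RInt_ray n d f x z Hf Hxz) as I2.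
change (Rabs (minus (RInt (fun t => t ^ n * f u (t * v)) 0 1)
  (RInt (fun t => t ^ n * f x (t * z)) 0 1)) < eps).
rewrite <- (RInt_minus (fun t => t ^ n * f u (t * v)) (fun t => t ^ n * f x (t * z))) by assumption.
apply Rle_lt_trans with ((1 - 0) * (eps / 2)); [|lra].
apply abs_RInt_le_const; [lra| |].
- now apply (ex_RInt_minus (fun t => t ^ n * f u (t * v)) (fun t => t ^ n * f x (t * z))).
- intros t Ht. unfold minus, plus, opp. simpl.
  replace (_ + _) with (t ^ n * (f u (t * v) - f x (t * z))) by ring.
  rewrite Rabs_mult. rewrite <- (Rmult_1_l (eps / 2)).
  apply Rmult_le_compat; try apply Rabs_pos.
  + rewrite Rabs_pos_eq by (apply pow_le; lra). rewrite <- (pow1 n). apply pow_incr. lra.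
  + left.
    assert (Hb : forall w, Rabs w < r -> - r <= t * w <= r).
    { intros w Hw. assert (Hbw : box r (0, w)).
      { split; simpl; auto. rewrite Rabs_R0. pose proof (Rabs_pos x). lra. }
      destruct (box_ray r 0 w t Hbw Ht) as [_ H6]. simpl in H6. apply Rabs_def2 in H6. lra. }
    apply Rabs_def2 in Hur. pose proof (proj1 Hr) as Hxr. apply Rabs_def2 in Hxr.
    apply Hdel; try lra; try apply Hb; try lra.
    replace (t * v - t * z) with (t * (v - z)) by ring.
    rewrite Rabs_mult, (Rabs_pos_eq t) by lra. pose proof (Rabs_pos (v - z)). nra.
Qed.

Lemma is_derive_ray_mean_x n d f x z : smooth_on (box d) f -> box d (x, z) ->
  is_derive (fun u => ray_mean n f u z) x (ray_mean n (dx f) x z).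
Proof.
intros Hf Hxz. pose proof (smooth_on_dx _ _ Hf) as Hfx.
assert (Hloc : locally x (fun u => box d (u, z))).
{ apply (locally_2d_1d_x (fun u v => box d (u, v))). apply open_locally_2d; auto. apply open_box. }
assert (HD : forall u t, Derive (fun w => t ^ n * f w (t * z)) u = t ^ n * dx f u (t * z)).
{ intros u t. now rewrite Derive_scal. }
replace (ray_mean n (dx f) x z)
  with (RInt (fun t => Derive (fun u => t ^ n * f u (t * z)) x) 0 1).
2: { apply RInt_ext. intros t _. apply HD. }
apply (is_derive_RInt_param (fun u t => t ^ n * f u (t * z)) 0 1 x).
- generalize Hloc. apply filter_imp. rewrite Rmin_left, Rmax_right by lra. intros u Hu t Ht.
  apply (ex_derive_scal (fun w => f w (t * z))). exists (dx f u (t * z)).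
  apply (smooth_on_is_derive_x (box d)); auto. now apply box_ray.
- rewrite Rmin_left, Rmax_right by lra. intros t Ht.
  apply continuity_2d_pt_ext with (fun u v => v ^ n * dx f u (v * z)).
  { intros u v. now rewrite HD. }
  apply continuity_ray. apply (smooth_on_continuity (box d)); auto. now apply box_ray.
- generalize Hloc. apply filter_imp. intros u Hu. now apply ex_RInt_ray with d.
Qed.

Lemma is_derive_along_ray d f x z t : smooth_on (box d) f -> box d (x, t * z) ->
  is_derive (fun v => f x (t * v)) z (t * dy f x (t * z)).
Proof.
intros Hf Hxz. apply (is_derive_comp (fun v => f x v) (fun v => t * v)).
- now apply (smooth_on_is_derive_y (box d)).
- auto_derive; auto. ring.
Qed.

Lemma is_derive_ray_mean_y n d f x z : smooth_on (box d) f -> box d (x, z) ->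
  is_derive (fun v => ray_mean n f x v) z (ray_mean (S n) (dy f) x z).
Proof.
intros Hf Hxz. pose proof (smooth_on_dy _ _ Hf) as Hfy.
assert (Hloc : locally z (fun v => box d (x, v))).
{ apply (locally_2d_1d_y (fun u v => box d (u, v))). apply open_locally_2d; auto. apply open_box. }
assert (HD : forall v t, box d (x, t * v) ->
  Derive (fun w => t ^ n * f x (t * w)) v = t ^ S n * dy f x (t * v)).
{ intros v t Ht. rewrite Derive_scal, (Derive_eq (fun w => f x (t * w)) v _ (is_derive_along_ray d f x v t Hf Ht)).
  simpl. ring. }
replace (ray_mean (S n) (dy f) x z)
  with (RInt (fun t => Derive (fun v => t ^ n * f x (t * v)) z) 0 1).
2: { apply RInt_ext. rewrite Rmin_left, Rmax_right by lra. intros t Ht.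
     apply HD. apply box_ray; auto. lra. }
apply (is_derive_RInt_param (fun v t => t ^ n * f x (t * v)) 0 1 z).
- generalize Hloc. apply filter_imp. rewrite Rmin_left, Rmax_right by lra. intros v Hv t Ht.
  apply (ex_derive_scal (fun w => f x (t * w))). exists (t * dy f x (t * v)).
  apply (is_derive_along_ray d); auto. now apply box_ray.
- rewrite Rmin_left, Rmax_right by lra. intros t Ht.
  assert (Hmul : continuity_2d_pt (fun v s => s * v) z t).
  { apply continuity_2d_pt_mult; [apply continuity_2d_pt_id2|apply continuity_2d_pt_id1]. }
  apply continuity_2d_pt_ext_loc with (fun v s => s ^ S n * dy f x (s * v)).
  + destruct (open_locally_2d (box d) x (t * z) (open_box d) (box_ray d x z t Hxz Ht)) as [e He].
    generalize (Hmul e). apply locally_2d_imp. intros v s Hs. symmetry. apply HD, He; auto.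
    rewrite Rminus_diag, Rabs_R0. apply cond_pos.
  + apply continuity_2d_pt_mult; [apply continuity_2d_pt_pow|].
    apply (continuity_2d_pt_comp (dy f) (fun _ _ => x) (fun v s => s * v)); auto.
    * apply (smooth_on_continuity (box d)); auto. now apply box_ray.
    * apply continuity_2d_pt_const.
- generalize Hloc. apply filter_imp. intros v Hv. now apply ex_RInt_ray with d.
Qed.

Lemma smooth_on_ray_mean n d f : smooth_on (box d) f -> smooth_on (box d) (ray_mean n f).
Proof.
intros Hf k. revert n f Hf. induction k as [|k IH]; intros n f Hf.
- split; [|trivial]. intros x z. now apply continuity_ray_mean.
- split; [|split; [|split]].
  + intros x z. now apply continuity_ray_mean.
  + intros x z Hxz. split; eexists.
    * now apply (is_derive_ray_mean_x n d).
    * now apply (is_derive_ray_mean_y n d).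
  + apply Ck_on_ext with (ray_mean n (dx f)).
    * apply open_box.
    * intros x z Hxz. symmetry. apply Derive_eq. now apply (is_derive_ray_mean_x n d).
    * apply IH. now apply smooth_on_dx.
  + apply Ck_on_ext with (ray_mean (S n) (dy f)).
    * apply open_box.
    * intros x z Hxz. symmetry. apply Derive_eq. now apply (is_derive_ray_mean_y n d).
    * apply IH. now apply smooth_on_dy.
Qed.

Lemma hadamard_factor d f : smooth_on (box d) f ->
  (forall x, Rabs x < d -> f x 0 = 0) ->
  forall x z, box d (x, z) -> f x z = z * ray_mean 0 (dy f) x z.
Proof.
intros Hf H0 x z Hxz. pose proof (smooth_on_dy _ _ Hf) as Hfy.
unfold ray_mean. change (f x z = scal z (RInt (fun t => t ^ 0 * dy f x (t * z)) 0 1)).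
rewrite <- (RInt_scal (fun t => t ^ 0 * dy f x (t * z))) by now apply ex_RInt_ray with d.
symmetry. apply is_RInt_unique.
replace (f x z) with (minus (f x (1 * z)) (f x (0 * z))).
2: { unfold minus, plus, opp. simpl. rewrite Rmult_0_l, Rmult_1_l, H0 by apply Hxz. ring. }
apply (is_RInt_derive (fun t => f x (t * z))); rewrite Rmin_left, Rmax_right by lra; intros t Ht.
- unfold scal. simpl. unfold mult. simpl. rewrite Rmult_1_l.
  apply (is_derive_comp (fun v => f x v) (fun t => t * z)).
  + apply (smooth_on_is_derive_y (box d)); auto. now apply box_ray.
  + auto_derive; auto. ring.
- apply (continuous_scal_r z (fun t => t ^ 0 * dy f x (t * z))).
  apply continuity_pt_filterlim.
  apply (continuity_2d_pt_y (fun u v => v ^ 0 * dy f u (v * z)) x t), continuity_ray.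
  apply (smooth_on_continuity (box d)); auto. now apply box_ray.
Qed.

Lemma dy_mult_snd d k x z : smooth_on (box d) k -> box d (x, z) ->
  dy (fun x z => z * k x z) x z = k x z + z * dy k x z.
Proof.
intros Hk Hxz. apply Derive_eq.
replace (k x z + z * dy k x z) with (1 * k x z + z * dy k x z) by ring.
apply (is_derive_mult (fun t => t) (fun t => k x t)).
- apply (is_derive_id z).
- now apply (smooth_on_is_derive_y (box d)).
- intros; apply Rmult_comm.
Qed.

(** The last clause carries derivatives on the axis over to the quotient, so that the division can
    be repeated; order three is what lets three divisions relate the final quotient at the origin to
    the third derivative of [f]. *)
Lemma hadamard_division d f : smooth_on (box d) f ->
  (forall x, Rabs x < d -> f x 0 = 0) ->
  exists k, smooth_on (box d) k /\
    (forall x z, box d (x, z) -> f x z = z * k x z) /\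
    (forall x, Rabs x < d -> dy f x 0 = k x 0 /\ dy (dy f) x 0 = 2 * dy k x 0 /\
       dy (dy (dy f)) x 0 = 3 * dy (dy k) x 0).
Proof.
intros Hf H0. exists (ray_mean 0 (dy f)).
set (k := ray_mean 0 (dy f)).
assert (Hk : smooth_on (box d) k) by (apply smooth_on_ray_mean; now apply smooth_on_dy).
pose proof (smooth_on_dy _ _ Hk) as Hk1. pose proof (smooth_on_dy _ _ Hk1) as Hk2.
pose proof (open_box d) as Hop.
assert (E : forall x z, box d (x, z) -> f x z = z * k x z) by now apply hadamard_factor.
assert (E1 : forall x z, box d (x, z) -> dy f x z = k x z + z * dy k x z).
{ intros x z Hxz. rewrite (dy_ext_on (box d) f _ Hop E x z Hxz). now apply (dy_mult_snd d). }
assert (Dplus : forall a b x z, smooth_on (box d) a -> smooth_on (box d) b -> box d (x, z) ->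
  dy (fun x z => a x z + b x z) x z = dy a x z + dy b x z).
{ intros a b x z Ha Hb Hxz. apply Derive_eq.
  apply (is_derive_plus (fun t => a x t) (fun t => b x t)); now apply (smooth_on_is_derive_y (box d)). }
assert (Sz : forall a, smooth_on (box d) a -> smooth_on (box d) (fun x z => z * a x z)).
{ intros a Ha. apply smooth_on_mult; auto. now apply smooth_on_snd. }
assert (E2 : forall x z, box d (x, z) -> dy (dy f) x z = 2 * dy k x z + z * dy (dy k) x z).
{ intros x z Hxz. rewrite (dy_ext_on (box d) (dy f) _ Hop E1 x z Hxz), Dplus; auto.
  rewrite (dy_mult_snd d) by auto. ring. }
assert (E3 : forall x z, box d (x, z) ->
  dy (dy (dy f)) x z = 3 * dy (dy k) x z + z * dy (dy (dy k)) x z).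
{ intros x z Hxz. rewrite (dy_ext_on (box d) (dy (dy f)) _ Hop E2 x z Hxz).
  rewrite (Dplus (fun x z => 2 * dy k x z)); auto.
  - rewrite (dy_mult_snd d) by auto. unfold dy at 1. rewrite Derive_scal.
    change (Derive (dy k x) z) with (dy (dy k) x z). ring.
  - apply smooth_on_mult; auto. now apply smooth_on_const. }
split; [assumption|]. split; [assumption|]. intros x Hx.
pose proof (box_axis d x Hx) as Hx0. rewrite E1, E2, E3 by assumption.
repeat split; ring.
Qed.

(** * Implicit functions *)

Lemma increasing_in_y d F x y1 y2 : smooth_on (box d) F ->
  (forall x y, box d (x, y) -> 0 < dy F x y) ->
  box d (x, y1) -> box d (x, y2) -> y1 < y2 -> F x y1 < F x y2.
Proof.
intros HF Hpos [Hx H1] [_ H2] Hlt. simpl in *.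
apply Rabs_def2 in H1. apply Rabs_def2 in H2.
assert (Hb : forall y, y1 <= y <= y2 -> box d (x, y)).
{ intros y Hy. split; simpl; auto. apply Rabs_def1; lra. }
destruct (MVT_gen (fun y => F x y) y1 y2 (fun y => dy F x y)) as [c [Hc Hmvt]].
- rewrite Rmin_left, Rmax_right by lra. intros y Hy.
  apply (smooth_on_is_derive_y (box d)); auto. apply Hb. lra.
- rewrite Rmin_left, Rmax_right by lra. intros y Hy.
  eapply is_derive_continuity_pt. apply (smooth_on_is_derive_y (box d)); auto.
- rewrite Rmin_left, Rmax_right in Hc by lra. pose proof (Hpos x c (Hb c Hc)).
  assert (0 < dy F x c * (y2 - y1)) by (apply Rmult_lt_0_compat; lra). lra.
Qed.

Lemma root_in_y d F x y1 y2 : smooth_on (box d) F -> y1 < y2 ->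
  (forall y, y1 <= y <= y2 -> box d (x, y)) -> F x y1 < 0 -> 0 < F x y2 ->
  {y | y1 <= y <= y2 /\ F x y = 0}.
Proof.
intros HF Hlt Hb H1 H2. apply (IVT_interv (F x)); auto.
intros y Hy. apply continuity_2d_pt_y, (smooth_on_continuity (box d)); auto.
Qed.

Lemma locally_2d_pos f x y : continuity_2d_pt f x y -> 0 < f x y ->
  locally_2d (fun u v => 0 < f u v) x y.
Proof.
intros H Hpos. generalize (H (mkposreal _ Hpos)). apply locally_2d_imp. simpl.
intros u v Huv. apply Rabs_def2 in Huv. lra.
Qed.

Lemma continuity_pt_sign_near (f : R -> R) x : continuity_pt f x -> 0 < f x ->
  exists e, 0 < e /\ forall y, Rabs (y - x) < e -> 0 < f y.
Proof.
intros H Hpos. destruct (continuity_pt_near f x (f x) H Hpos) as [e [He H']].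
exists e. split; auto. intros y Hy. pose proof (Rabs_def2 _ _ (H' y Hy)). lra.
Qed.

(** Along the zero set, [a h + b k] is small compared with the larger of [|h|] and [|k|], where [k]
    is the increment of [s]. A first, crude use of this bounds [|k|] by [c |h|]; a second use then
    gives the derivative. *)
Lemma is_derive_implicit (F : R -> R -> R) s x a b :
  differentiable_pt_lim F x (s x) a b -> 0 < b -> continuity_pt s x ->
  (exists e, 0 < e /\ forall u, Rabs (u - x) < e -> F u (s u) = 0) ->
  is_derive s x (- a / b).
Proof.
intros HF Hb Hs [e [He HFs]]. apply is_derive_Reals. intros eps Heps.
(* This [c] solves [b |k| <= |a| |h| + b / 2 * (|h| + |k|)] for [|k|], the error factor being at
   most [b / 2]. The other bound [eps * b / (2 * c)] on that factor leaves a final error of at most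
   [eps / 2]. *)
set (c := 2 * Rabs a / b + 1).
assert (Hc : 1 <= c).
{ unfold c. pose proof (Rabs_pos a).
  assert (0 <= 2 * Rabs a / b) by (apply Rdiv_le_0_compat; lra). lra. }
assert (Hcb : c * b = 2 * Rabs a + b) by (unfold c; field; lra).
assert (Heb : 0 < Rmin (b / 2) (eps * b / (2 * c))).
{ apply Rmin_pos; [lra|]. apply Rdiv_lt_0_compat; [|lra]. now apply Rmult_lt_0_compat. }
set (e' := Rmin (b / 2) (eps * b / (2 * c))) in *.
assert (He' : e' <= b / 2 /\ e' * c <= eps * b / 2).
{ split; [apply Rmin_l|]. apply Rle_trans with (eps * b / (2 * c) * c).
  - apply Rmult_le_compat_r; [lra|apply Rmin_r].
  - right. field. lra. }
destruct (HF (mkposreal _ Heb)) as [d1 Hd1]. simpl in Hd1.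
destruct (continuity_pt_near s x d1 Hs (cond_pos d1)) as [d2 [Hd2 Hs2]].
assert (Hd : 0 < Rmin d1 (Rmin d2 e)).
{ repeat apply Rmin_pos; auto. apply cond_pos. }
exists (mkposreal _ Hd). simpl. intros h Hh0 Hh.
pose proof (Rmin_l d1 (Rmin d2 e)). pose proof (Rmin_r d1 (Rmin d2 e)).
pose proof (Rmin_l d2 e). pose proof (Rmin_r d2 e).
assert (Hxh : x + h - x = h) by ring.
assert (Hu1 : Rabs (x + h - x) < d1) by (rewrite Hxh; lra).
assert (Hu2 : Rabs (x + h - x) < d2) by (rewrite Hxh; lra).
assert (Hu3 : Rabs (x + h - x) < e) by (rewrite Hxh; lra).
pose proof (Hd1 _ _ Hu1 (Hs2 _ Hu2)) as Hest.
rewrite (HFs _ Hu3), (HFs x) in Hest by (rewrite Rminus_diag, Rabs_R0; auto).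
set (k := s (x + h) - s x) in *. rewrite Hxh in Hest.
replace (0 - 0 - (a * h + b * k)) with (- (a * h + b * k)) in Hest by ring.
rewrite Rabs_Ropp in Hest.
assert (Hh' : 0 < Rabs h) by now apply Rabs_pos_lt.
pose proof (Rabs_pos k) as Hk0.
assert (Hk : Rabs k <= c * Rabs h).
{ assert (H4 : b * Rabs k <= Rabs (a * h + b * k) + Rabs a * Rabs h).
  { pose proof (Rabs_triang (a * h + b * k) (- (a * h))) as H4.
    rewrite Rabs_Ropp in H4. replace (a * h + b * k + - (a * h)) with (b * k) in H4 by ring.
    rewrite !Rabs_mult, (Rabs_pos_eq b) in H4 by lra. exact H4. }
  assert (H5 : e' * Rmax (Rabs h) (Rabs k) <= b / 2 * (Rabs h + Rabs k)).
  { apply Rmult_le_compat; try lra.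
    - apply Rle_trans with (1 := Rabs_pos h), Rmax_l.
    - apply Rmax_lub; lra. }
  apply (Rmult_le_reg_l b); auto.
  replace (b * (c * Rabs h)) with ((2 * Rabs a + b) * Rabs h) by (rewrite <- Hcb; ring).
  lra. }
assert (Hmax : Rmax (Rabs h) (Rabs k) <= c * Rabs h) by (apply Rmax_lub; nra).
replace (k / h - - a / b) with ((a * h + b * k) / (b * h)) by (field; lra).
unfold Rdiv. rewrite Rabs_mult, Rabs_inv, Rabs_mult, (Rabs_pos_eq b) by lra.
apply (Rmult_lt_reg_r (b * Rabs h)); [now apply Rmult_lt_0_compat|].
replace (Rabs (a * h + b * k) * / (b * Rabs h) * (b * Rabs h)) with (Rabs (a * h + b * k))
  by (field; lra).
apply Rle_lt_trans with (e' * (c * Rabs h)).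
- apply Rle_trans with (1 := Hest). apply Rmult_le_compat_l; lra.
- assert (e' * c * Rabs h <= eps * b / 2 * Rabs h) by (apply Rmult_le_compat_r; lra).
  assert (0 < eps * b * Rabs h) by (repeat apply Rmult_lt_0_compat; lra). lra.
Qed.

(** Since [F] increases strictly in [y], the intermediate value theorem yields exactly one root in
    the strip, and the same monotonicity gives its continuity. Smoothness is bootstrapped from
    [s' = - F_x / F_y] along the graph. *)
Lemma implicit_function_pos d F : 0 < d -> smooth_on (box d) F -> F 0 0 = 0 -> 0 < dy F 0 0 ->
  exists e s, 0 < e <= d /\ smooth1 e s /\ s 0 = 0 /\
    forall x, Rabs x < e -> box d (x, s x) /\ F x (s x) = 0.
Proof.
intros Hd HF F0 HFy.
assert (H00 : box d (0, 0)) by (apply box_axis; rewrite Rabs_R0; assumption).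
destruct (proj1 (locally_2d_box _) (locally_2d_pos (dy F) 0 0
  (smooth_on_continuity _ _ _ _ (smooth_on_dy _ _ HF) H00) HFy)) as [r0 [Hr0 Hpos0]].
set (r := Rmin d r0).
assert (Hr : 0 < r) by now apply Rmin_pos.
assert (Hrd : r <= d) by apply Rmin_l.
assert (HFr : smooth_on (box r) F).
{ apply smooth_on_subset with (box d); auto. intros p. now apply box_le. }
assert (Hpos : forall x y, box r (x, y) -> 0 < dy F x y).
{ intros x y Hxy. apply Hpos0. apply box_le with r; auto. apply Rmin_r. }
set (h := r / 2).
assert (Hbox : forall x y, Rabs x < r -> - h <= y <= h -> box r (x, y)).
{ intros x y Hx Hy. split; simpl; auto. apply Rabs_def1; unfold h in *; lra. }
assert (H0r : Rabs 0 < r) by now rewrite Rabs_R0.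
assert (Hh : 0 < h) by (unfold h; lra).
assert (Hc : forall y, - h <= y <= h -> continuity_pt (fun x => F x y) 0).
{ intros y Hy. apply continuity_2d_pt_x, (smooth_on_continuity (box r)); auto. }
destruct (continuity_pt_sign_near (fun x => F x h) 0) as [e1 [He1 Hup]].
{ apply Hc. lra. }
{ assert (F 0 0 < F 0 h); [|lra].
  apply (increasing_in_y r); auto; try (apply Hbox; auto); lra. }
destruct (continuity_pt_sign_near (fun x => - F x (- h)) 0) as [e2 [He2 Hdn]].
{ apply continuity_pt_opp, Hc. lra. }
{ assert (F 0 (- h) < F 0 0); [|lra].
  apply (increasing_in_y r); auto; try (apply Hbox; auto); lra. }
set (e := Rmin r (Rmin e1 e2)).
assert (He : 0 < e /\ e <= r /\ e <= e1 /\ e <= e2).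
{ pose proof (Rmin_l r (Rmin e1 e2)). pose proof (Rmin_r r (Rmin e1 e2)).
  pose proof (Rmin_l e1 e2). pose proof (Rmin_r e1 e2).
  assert (0 < e) by (repeat apply Rmin_pos; lra). unfold e in *. lra. }
(* The condition on [x] is placed inside the [sig] type, with the default root [0] outside the
   interval, so that [s] is a total function obtained by projection from the informative
   intermediate value theorem. *)
assert (Hroot : forall x, {y | Rabs x < e -> - h <= y <= h /\ F x y = 0}).
{ intros x. destruct (Rlt_dec (Rabs x) e) as [Hx|Hx].
  - destruct (root_in_y r F x (- h) h) as [y Hy]; auto; try lra.
    + intros y Hy. apply Hbox; auto. lra.
    + assert (0 < - F x (- h)); [|lra]. apply Hdn. rewrite Rminus_0_r. lra.
    + apply Hup. rewrite Rminus_0_r. lra.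
    + exists y. auto.
  - exists 0. intros H. contradiction. }
set (s := fun x => proj1_sig (Hroot x)).
assert (Hs : forall x, Rabs x < e -> - h <= s x <= h /\ F x (s x) = 0).
{ intros x. unfold s. exact (proj2_sig (Hroot x)). }
assert (Hsb : forall x, Rabs x < e -> box r (x, s x)).
{ intros x Hx. apply Hbox; [lra|apply Hs; auto]. }
assert (Hscont : forall x, Rabs x < e -> continuity_pt s x).
(* Pinching: near [x], [F] stays positive at height [s x + eta] and negative at [s x - eta], so the
   root stays strictly between them. *)
{ intros x Hx. apply continuity_pt_locally. intros eps.
  destruct (open_locally_2d (box r) x (s x) (open_box r) (Hsb x Hx)) as [q Hq].
  set (eta := Rmin (eps / 2) (q / 2)).
  assert (Heta : 0 < eta /\ eta < eps /\ eta < q).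
  { pose proof (cond_pos eps). pose proof (cond_pos q).
    pose proof (Rmin_l (eps / 2) (q / 2)). pose proof (Rmin_r (eps / 2) (q / 2)).
    assert (0 < eta) by (apply Rmin_pos; lra). unfold eta in *. lra. }
  assert (Hxx : Rabs (x - x) < q) by (rewrite Rminus_diag, Rabs_R0; apply cond_pos).
  assert (Hb1 : box r (x, s x + eta)).
  { apply Hq; auto. replace (s x + eta - s x) with eta by ring. rewrite Rabs_pos_eq; lra. }
  assert (Hb2 : box r (x, s x - eta)).
  { apply Hq; auto. replace (s x - eta - s x) with (- eta) by ring.
    rewrite Rabs_Ropp, Rabs_pos_eq; lra. }
  destruct (continuity_pt_sign_near (fun u => F u (s x + eta)) x) as [e3 [He3 Hup3]].
  { apply continuity_2d_pt_x, (smooth_on_continuity (box r)); auto. }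
  { rewrite <- (proj2 (Hs x Hx)). apply (increasing_in_y r); auto. lra. }
  destruct (continuity_pt_sign_near (fun u => - F u (s x - eta)) x) as [e4 [He4 Hdn4]].
  { apply continuity_pt_opp, continuity_2d_pt_x, (smooth_on_continuity (box r)); auto. }
  { assert (F x (s x - eta) < F x (s x)); [|rewrite (proj2 (Hs x Hx)) in H; lra].
    apply (increasing_in_y r); auto. lra. }
  assert (Hm : 0 < Rmin (e - Rabs x) (Rmin e3 e4)) by (repeat apply Rmin_pos; lra).
  exists (mkposreal _ Hm). intros u Hu. unfold ball in Hu; simpl in Hu.
  unfold AbsRing_ball, abs, minus, plus, opp in Hu. simpl in Hu.
  fold (u - x) in Hu.
  pose proof (Rmin_l (e - Rabs x) (Rmin e3 e4)). pose proof (Rmin_r (e - Rabs x) (Rmin e3 e4)).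
  pose proof (Rmin_l e3 e4). pose proof (Rmin_r e3 e4). pose proof (Rabs_triang_inv u x).
  assert (Hue : Rabs u < e) by lra. assert (Hur : Rabs u < r) by lra.
  pose proof (proj2 (Hs u Hue)) as Hsu.
  assert (Hu3 : 0 < F u (s x + eta)) by (apply Hup3; lra).
  assert (Hu4 : 0 < - F u (s x - eta)) by (apply Hdn4; lra).
  assert (Hbu1 : box r (u, s x + eta)) by (split; [exact Hur|apply Hb1]).
  assert (Hbu2 : box r (u, s x - eta)) by (split; [exact Hur|apply Hb2]).
  apply Rlt_trans with eta; [|lra]. apply Rabs_def1.
  - destruct (Rlt_or_le (s u) (s x + eta)) as [|[Hlt|Heq]]; [lra| |].
    + pose proof (increasing_in_y r F u _ _ HFr Hpos Hbu1 (Hsb u Hue) Hlt). lra.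
    + rewrite <- Heq in Hsu. lra.
  - destruct (Rlt_or_le (s x - eta) (s u)) as [|[Hlt|Heq]]; [lra| |].
    + pose proof (increasing_in_y r F u _ _ HFr Hpos (Hsb u Hue) Hbu2 Hlt). lra.
    + rewrite Heq in Hsu. lra. }
assert (Hder : forall x, Rabs x < e ->
  is_derive s x (- dx F x (s x) / dy F x (s x))).
{ intros x Hx. apply (is_derive_implicit F); auto.
  - apply (smooth_on_differentiable (box r)); auto. apply open_box.
  - exists (e - Rabs x). split; [lra|]. intros u Hu.
    pose proof (Rabs_triang_inv u x). apply Hs. lra. }
pose proof (open_box r) as Hor. pose proof (open_box e) as Hoe.
assert (HQ : smooth_on (box r) (fun x y => - dx F x y / dy F x y)).
{ apply smooth_on_div; auto.
  - apply smooth_on_opp; auto. now apply smooth_on_dx.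
  - now apply smooth_on_dy.
  - intros x y Hxy. pose proof (Hpos x y Hxy). lra. }
exists e, s. split; [lra|]. split; [|split].
(* The derivative of [s] is a smooth quotient evaluated along the graph of [s], so regularity of
   order [k] implies order [S k]. *)
- intros k. induction k as [|k IH].
  + split; [|trivial]. intros x y [Hx _].
    apply (continuity_1d_2d_pt_comp s (fun x _ => x)); auto. apply continuity_2d_pt_id1.
  + apply Ck_on_intro with (fun x _ => - dx F x (s x) / dy F x (s x)) (fun _ _ => 0); auto.
    * intros x y [Hx _]. apply differentiable_pt_lim_proj1_0, is_derive_Reals. auto.
    * apply (Ck_on_comp k (box e) (box r) (fun x y => - dx F x y / dy F x y) (fun x _ => x)
        (fun x _ => s x)); auto.
      -- now apply Ck_on_fst.
      -- intros x y [Hx _]. auto.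
    * now apply Ck_on_const.
- assert (H0e : Rabs 0 < e) by (rewrite Rabs_R0; lra). pose proof (proj2 (Hs 0 H0e)) as Hs0.
  assert (Hb0 : box r (0, 0)) by now apply box_axis.
  destruct (Rtotal_order (s 0) 0) as [Hlt|[Heq|Hgt]]; [exfalso|assumption|exfalso].
  + pose proof (increasing_in_y r F 0 _ _ HFr Hpos (Hsb 0 H0e) Hb0 Hlt). lra.
  + pose proof (increasing_in_y r F 0 _ _ HFr Hpos Hb0 (Hsb 0 H0e) Hgt). lra.
- intros x Hx. split; [apply box_le with r; auto|apply Hs; auto].
Qed.

Lemma implicit_function d F : 0 < d -> smooth_on (box d) F -> F 0 0 = 0 -> dy F 0 0 <> 0 ->
  exists e s, 0 < e <= d /\ smooth1 e s /\ s 0 = 0 /\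
    forall x, Rabs x < e -> box d (x, s x) /\ F x (s x) = 0.
Proof.
intros Hd HF F0 HFy. destruct (Rdichotomy _ _ HFy) as [Hneg|Hpos].
- destruct (implicit_function_pos d (fun x y => - F x y)) as [e [s [He [Hs [Hs0 H]]]]]; auto.
  + apply smooth_on_opp; auto. apply open_box.
  + lra.
  + unfold dy at 1. rewrite Derive_opp. change (0 < - dy F 0 0). lra.
  + exists e, s. split; [assumption|]. split; [assumption|]. split; [assumption|].
    intros x Hx. destruct (H x Hx) as [Hb Hx0]. split; [assumption|lra].
- now apply implicit_function_pos.
Qed.

(** * Reduction to normal form *)

Ltac prove_smooth :=
  repeat (first [ assumption | apply smooth_on_plus | apply smooth_on_minus
    | apply smooth_on_mult | apply smooth_on_dx | apply smooth_on_dy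
    | apply smooth_on_const | apply smooth_on_fst | apply smooth_on_snd ]).

Lemma dy_plus U f g x y : smooth_on U f -> smooth_on U g -> U (x, y) ->
  dy (fun x y => f x y + g x y) x y = dy f x y + dy g x y.
Proof.
intros Hf Hg Hxy. apply Derive_eq.
apply (is_derive_plus (fun t => f x t) (fun t => g x t)); now apply (smooth_on_is_derive_y U).
Qed.

Lemma dy_mult U f g x y : smooth_on U f -> smooth_on U g -> U (x, y) ->
  dy (fun x y => f x y * g x y) x y = dy f x y * g x y + f x y * dy g x y.
Proof.
intros Hf Hg Hxy. apply Derive_eq.
apply (is_derive_mult (fun t => f x t) (fun t => g x t)); try now apply (smooth_on_is_derive_y U).
intros; apply Rmult_comm.
Qed.

Lemma discriminant_equation_derivatives U g c : open U -> smooth_on U g -> smooth_on U c ->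
  (forall x y, U (x, y) -> dx g x y * dx g x y + c x y * dy g x y = g x y) ->
  forall x y, U (x, y) ->
  2 * dx g x y * dx (dy g) x y + dy c x y * dy g x y + c x y * dy (dy g) x y = dy g x y /\
  2 * dx (dy g) x y ^ 2 + 2 * dx g x y * dx (dy (dy g)) x y + dy (dy c) x y * dy g x y
    + 2 * dy c x y * dy (dy g) x y + c x y * dy (dy (dy g)) x y = dy (dy g) x y /\
  6 * dx (dy g) x y * dx (dy (dy g)) x y + 2 * dx g x y * dx (dy (dy (dy g))) x y
    + dy (dy (dy c)) x y * dy g x y + 3 * dy (dy c) x y * dy (dy g) x y
    + 3 * dy c x y * dy (dy (dy g)) x y + c x y * dy (dy (dy (dy g))) x y
    = dy (dy (dy g)) x y.
Proof.
intros HU Hg Hc E0.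
(* Mixed derivatives are normalised with [dx] outermost, so that equal terms become syntactically
   equal for [lra]. *)
assert (C : forall f x y, smooth_on U f -> U (x, y) -> dy (dx f) x y = dx (dy f) x y).
{ intros f x y Hf Hxy. symmetry. now apply (dx_dy_comm U). }
assert (E1 : forall x y, U (x, y) ->
  (dx (dy g) x y * dx g x y + dx g x y * dx (dy g) x y)
  + (dy c x y * dy g x y + c x y * dy (dy g) x y) = dy g x y).
{ intros x y Hxy. pose proof (dy_ext_on U _ _ HU E0 x y Hxy) as H.
  rewrite !(dy_plus U), !(dy_mult U), !C in H by (assumption || prove_smooth). lra. }
assert (E2 : forall x y, U (x, y) ->
  (dx (dy (dy g)) x y * dx g x y + dx g x y * dx (dy (dy g)) x y)
  + (dx (dy g) x y * dx (dy g) x y + dx (dy g) x y * dx (dy g) x y)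
  + (dy (dy c) x y * dy g x y + c x y * dy (dy (dy g)) x y)
  + (dy c x y * dy (dy g) x y + dy c x y * dy (dy g) x y) = dy (dy g) x y).
{ intros x y Hxy. pose proof (dy_ext_on U _ _ HU E1 x y Hxy) as H.
  rewrite !(dy_plus U), !(dy_mult U), !C in H by (assumption || prove_smooth). lra. }
intros x y Hxy. split; [|split].
- pose proof (E1 x y Hxy). lra.
- pose proof (E2 x y Hxy). lra.
- pose proof (dy_ext_on U _ _ HU E2 x y Hxy) as H.
  rewrite !(dy_plus U), !(dy_mult U), !C in H by (assumption || prove_smooth). lra.
Qed.

Lemma smooth1_graph d e f s : smooth_on (box d) f -> smooth1 e s ->
  (forall x, Rabs x < e -> box d (x, s x)) -> smooth1 e (fun x => f x (s x)).
Proof.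
intros Hf Hs Hb. pose proof (open_box e). pose proof (open_box d).
apply (smooth_on_comp (box e) (box d) f (fun x _ => x) (fun x _ => s x)); auto.
- now apply smooth_on_fst.
- intros x y [Hx _]. auto.
Qed.

(** On the curve [g_yy = 0] the chain rule gives [A' = g_xy], [B' = g_x + A s'] and
    [g_xyy = - g_yyy s']. The first [y]-derivative of the discriminant equation becomes the mixed
    relation. The second one is solved for [c], and substitution into the equation itself cancels
    the terms in [g_x] and leaves a right-hand side divisible by [A]. *)
Lemma critical_curve_system d g c : 0 < d -> smooth_on (box d) g -> smooth_on (box d) c ->
  (forall x y, box d (x, y) -> dx g x y * dx g x y + c x y * dy g x y = g x y) ->
  g 0 0 = 0 -> dy g 0 0 = 0 -> dy (dy g) 0 0 = 0 -> dy (dy (dy g)) 0 0 <> 0 ->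
  exists e s, 0 < e <= d /\ smooth1 e s /\ s 0 = 0 /\
    (forall x, Rabs x < e -> box d (x, s x) /\ dy (dy g) x (s x) = 0) /\
    exists a b m,
      critical_value_system e (fun x => dy g x (s x)) (fun x => g x (s x)) a b m.
Proof.
intros Hd Hg Hc E0 g00 gy00 gyy00 gyyy00. pose proof (open_box d) as Hop.
pose proof (discriminant_equation_derivatives (box d) g c Hop Hg Hc E0) as ED.
pose proof (smooth_on_dy _ _ Hg) as Hgy. pose proof (smooth_on_dy _ _ Hgy) as Hgyy.
pose proof (smooth_on_dy _ _ Hgyy) as Hgyyy.
destruct (implicit_function d (dy (dy g)) Hd Hgyy gyy00 gyyy00)
  as [e1 [s [He1 [Hs [Hs0 Hcrit]]]]].
assert (HE : smooth1 e1 (fun x => dy (dy (dy g)) x (s x))).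
{ apply (smooth1_graph d); auto. intros x Hx. now apply Hcrit. }
(* Within distance [|g_yyy(0, 0)|] of its value at the origin, [g_yyy] cannot vanish along the
   curve. *)
destruct (smooth1_near e1 (fun x => dy (dy (dy g)) x (s x)) (Rabs (dy (dy (dy g)) 0 0)))
  as [e [He HEnear]]; auto; [lra|now apply Rabs_pos_lt|].
rewrite Hs0 in HEnear.
assert (Hb : forall x, Rabs x < e -> box d (x, s x)) by (intros x Hx; apply Hcrit; lra).
assert (HEne : forall x, Rabs x < e -> dy (dy (dy g)) x (s x) <> 0).
{ intros x Hx H0. pose proof (HEnear x Hx) as H1. cbv beta in H1.
  rewrite H0, Rminus_0_l, Rabs_Ropp in H1. lra. }
assert (Hse : smooth1 e s) by (apply (smooth1_subset e1); auto; lra).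
exists e, s. split; [lra|]. split; [assumption|]. split; [assumption|].
split; [intros x Hx; apply Hcrit; lra|].
assert (H0e : Rabs 0 < e) by (rewrite Rabs_R0; lra).
assert (DA : forall x, Rabs x < e ->
  Derive (fun x => dy g x (s x)) x = dx (dy g) x (s x)).
{ intros x Hx. apply Derive_eq.
  replace (dx (dy g) x (s x)) with (dx (dy g) x (s x) + dy (dy g) x (s x) * Derive s x).
  - apply (is_derive_graph (box d)); auto. now apply (smooth1_derive e).
  - replace (dy (dy g) x (s x)) with 0 by (symmetry; apply Hcrit; lra). ring. }
assert (DB : forall x, Rabs x < e ->
  Derive (fun x => g x (s x)) x = dx g x (s x) + dy g x (s x) * Derive s x).
{ intros x Hx. apply Derive_eq. apply (is_derive_graph (box d)); auto.
  now apply (smooth1_derive e). }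
assert (DF : forall x, Rabs x < e ->
  dx (dy (dy g)) x (s x) = - dy (dy (dy g)) x (s x) * Derive s x).
{ intros x Hx.
  assert (dx (dy (dy g)) x (s x) + dy (dy (dy g)) x (s x) * Derive s x = 0); [|lra].
  apply (is_derive_locally_eq e (fun x => dy (dy g) x (s x)) (fun _ => 0) x); auto.
  - intros y Hy. apply Hcrit. lra.
  - apply (is_derive_graph (box d)); auto. now apply (smooth1_derive e).
  - apply (is_derive_const 0). }
pose proof (open_box e) as Hoe.
(* With [E = g_yyy], the second derivative gives [c = 2 g_x s' - (2 A' ^ 2 + c_yy A) / E]; hence
   [a = 2 / E] and [b = s' ^ 2 + c_yy / E]. In [m], the term [2 s' g_xy] comes from replacing [g_x]
   by [B' - A s']. *)
exists (fun x => 2 / dy (dy (dy g)) x (s x)).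
exists (fun x => Derive s x ^ 2 + dy (dy c) x (s x) / dy (dy (dy g)) x (s x)).
exists (fun x => 1 - dy c x (s x) + 2 * Derive s x * dx (dy g) x (s x)).
assert (HE' : smooth1 e (fun x => dy (dy (dy g)) x (s x))) by now apply (smooth1_graph d).
assert (HEne' : forall x y, box e (x, y) -> dy (dy (dy g)) x (s x) <> 0).
{ intros x y [Hx _]. auto. }
split; rewrite ?Hs0; auto; try lra.
- apply (smooth1_graph d); auto.
- apply (smooth1_graph d); auto.
- apply (smooth_on_div (box e) (fun _ _ => 2)); auto. now apply smooth_on_const.
- apply (smooth_on_plus (box e)); auto.
  + apply (smooth_on_pow (box e) (fun x _ => Derive s x)); auto. now apply smooth1_Derive.
  + apply (smooth_on_div (box e) (fun x _ => dy (dy c) x (s x))); auto.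
    refine (smooth1_graph d e (dy (dy c)) s _ Hse Hb). prove_smooth.
- apply (smooth_on_plus (box e) (fun x _ => 1 - dy c x (s x))); auto.
  + apply smooth_on_minus; auto; [now apply smooth_on_const|].
    refine (smooth1_graph d e (dy c) s _ Hse Hb). prove_smooth.
  + apply (smooth_on_mult (box e) (fun x _ => 2 * Derive s x)); auto.
    * apply smooth_on_mult; auto; [now apply smooth_on_const|now apply smooth1_Derive].
    * refine (smooth1_graph d e (dx (dy g)) s _ Hse Hb). prove_smooth.
- intros x Hx. rewrite DA, DB by assumption.
  destruct (ED x (s x) (Hb x Hx)) as [E1 _].
  replace (dy (dy g) x (s x)) with 0 in E1 by (symmetry; apply Hcrit; lra). lra.
- intros x Hx. rewrite DA, DB by assumption.
  destruct (ED x (s x) (Hb x Hx)) as [_ [E2 _]]. pose proof (E0 x (s x) (Hb x Hx)) as E0x.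
  replace (dy (dy g) x (s x)) with 0 in E2 by (symmetry; apply Hcrit; lra).
  rewrite DF in E2 by assumption. pose proof (HEne x Hx) as Hne.
  assert (Ec : c x (s x) = 2 * dx g x (s x) * Derive s x
    - (2 * dx (dy g) x (s x) ^ 2 + dy (dy c) x (s x) * dy g x (s x))
      / dy (dy (dy g)) x (s x)).
  { apply (Rmult_eq_reg_r (dy (dy (dy g)) x (s x))); auto. field_simplify; auto. lra. }
  rewrite <- E0x at 1. rewrite Ec. field. assumption.
- apply Rmult_integral_contrapositive. split; [lra|]. now apply Rinv_neq_0_compat.
(* With [g_x = g_xy = 0] at the origin, the second derivative of the equation gives [c = 0], the
   third then gives [3 c_y = 1], and [m 0 = 1 - 1/3]. *)
- rewrite DA, DB by assumption. rewrite Hs0, gy00. intros HA HB.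
  assert (Hb0 : box d (0, 0)) by (apply box_axis; rewrite Rabs_R0; lra).
  destruct (ED 0 0 Hb0) as [_ [E2 E3]]. rewrite HA, gy00, gyy00 in E2, E3.
  assert (Hp : dx g 0 0 = 0) by lra. rewrite Hp in E2, E3. rewrite HA.
  assert (Hc0 : c 0 0 = 0).
  { apply (Rmult_eq_reg_r (dy (dy (dy g)) 0 0)); auto. lra. }
  rewrite Hc0 in E3.
  assert (Hcy : dy c 0 0 = 1 / 3).
  { apply (Rmult_eq_reg_r (dy (dy (dy g)) 0 0)); auto. lra. }
  rewrite Hcy. lra.
Qed.

(** The two difference quotients coincide, so the identity holds for the total [Derive] at every
    point; [k] absorbs the subtracted value [beta x]. *)
Lemma Derive_shift (f : R -> R) (c k x : R) :
  Derive (fun t => f (t + c) + k) x = Derive f (x + c).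
Proof.
unfold Derive. f_equal. apply Lim_ext. intros h.
replace (x + h + c) with (x + c + h) by ring. unfold Rdiv. f_equal. ring.
Qed.

Lemma Rpower_third_cube x : 0 < x -> Rpower x (1 / 3) ^ 3 = x.
Proof.
intros Hx. rewrite <- Rpower_pow by apply exp_pos. rewrite Rpower_mult.
replace (1 / 3 * INR 3) with 1 by (simpl; field). now apply Rpower_1.
Qed.

(* After the shift [y = s x + z] three Hadamard divisions by [z] extract the
   factor [z ^ 3], and the cube root is taken of the remaining unit. *)
Lemma cubic_normal_form d e g s beta : 0 < e <= d -> smooth_on (box d) g ->
  smooth1 e s -> smooth1 e beta -> s 0 = 0 ->
  (forall x, Rabs x < e -> g x (s x) = beta x /\ dy g x (s x) = 0 /\ dy (dy g) x (s x) = 0) ->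
  dy (dy (dy g)) 0 0 <> 0 ->
  exists yt, second_coordinate yt /\
    locally_2d (fun x y => g x y = yt x y ^ 3 + beta x) 0 0.
Proof.
intros He Hg Hs Hbeta Hs0 Hcrit Hyyy.
(* Both the shear [y -> y + s x] and its inverse map a small enough square into a given one, because
   [s] is continuous with [s 0 = 0]. *)
assert (Hshrink : forall q, 0 < q -> exists r, 0 < r <= e /\ r <= q /\
  forall x y, box r (x, y) -> box q (x, y + s x) /\ box q (x, y + - s x)).
{ intros q Hq. destruct (smooth1_near e s (q / 2)) as [r [Hr Hsr]]; auto; try lra.
  rewrite Hs0 in Hsr. exists (Rmin r (q / 2)).
  pose proof (Rmin_l r (q / 2)). pose proof (Rmin_r r (q / 2)).
  assert (0 < Rmin r (q / 2)) by (apply Rmin_pos; lra).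
  split; [lra|]. split; [lra|]. intros x y [Hx Hy]. simpl in Hx, Hy.
  assert (Hxr : Rabs x < r) by lra. pose proof (Hsr x Hxr) as H2. rewrite Rminus_0_r in H2.
  split; split; simpl; try lra.
  - apply Rle_lt_trans with (1 := Rabs_triang _ _). lra.
  - apply Rle_lt_trans with (1 := Rabs_triang _ _). rewrite Rabs_Ropp. lra. }
destruct (Hshrink d) as [r [Hr [Hrd Hrb]]]; [lra|].
pose proof (open_box d) as Hod. pose proof (open_box r) as Hor.
assert (Hsr : smooth1 r s) by (apply (smooth1_subset e); auto; lra).
set (h := fun x z => g x (z + s x) + - beta x).
assert (Hh : smooth_on (box r) h).
{ apply smooth_on_plus; auto.
  - apply (smooth_on_comp (box r) (box d) g (fun x _ => x) (fun x z => z + s x)); auto.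
    + now apply smooth_on_fst.
    + apply smooth_on_plus; auto. now apply smooth_on_snd.
    + intros x z Hxz. now apply Hrb.
  - apply smooth_on_opp; auto. apply (smooth1_subset e); auto. lra. }
assert (D1 : forall x z, dy h x z = dy g x (z + s x)).
{ intros x z. apply Derive_shift. }
assert (D2 : forall x z, dy (dy h) x z = dy (dy g) x (z + s x)).
{ intros x z. unfold dy at 1. rewrite (Derive_ext _ (fun t => dy g x (t + s x) + 0)).
  - apply Derive_shift.
  - intros t. rewrite D1. ring. }
assert (D3 : forall x z, dy (dy (dy h)) x z = dy (dy (dy g)) x (z + s x)).
{ intros x z. unfold dy at 1. rewrite (Derive_ext _ (fun t => dy (dy g) x (t + s x) + 0)).
  - apply Derive_shift.
  - intros t. rewrite D2. ring. }
assert (Hh0 : forall x, Rabs x < r -> h x 0 = 0 /\ dy h x 0 = 0 /\ dy (dy h) x 0 = 0).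
{ intros x Hx. rewrite D1, D2. unfold h. rewrite Rplus_0_l.
  destruct (Hcrit x) as [-> [-> ->]]; [lra|]. repeat split; ring. }
assert (H0r : Rabs 0 < r) by (rewrite Rabs_R0; lra).
destruct (hadamard_division r h Hh) as [k1 [Hk1 [F1 J1]]]; [apply Hh0|].
destruct (hadamard_division r k1 Hk1) as [k2 [Hk2 [F2 J2]]].
{ intros x Hx. destruct (J1 x Hx) as [<- _]. now apply Hh0. }
destruct (hadamard_division r k2 Hk2) as [u [Hu [F3 J3]]].
{ intros x Hx. destruct (J2 x Hx) as [<- _]. destruct (J1 x Hx) as [_ [H _]].
  destruct (Hh0 x Hx) as [_ [_ H']]. lra. }
assert (Hu0 : u 0 0 <> 0).
{ destruct (J1 0 H0r) as [_ [_ H1]]. destruct (J2 0 H0r) as [_ [H2 _]].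
  destruct (J3 0 H0r) as [H3 _]. rewrite D3, Hs0, Rplus_0_l in H1. lra. }
assert (Hfac : forall x z, box r (x, z) -> h x z = z ^ 3 * u x z).
{ intros x z Hxz. rewrite F1, F2, F3 by assumption. ring. }
(* [Rpower] is a genuine root only on positive numbers, while [u] may be negative. The sign [sg] is
   put inside and outside the root; since [sg * sg = 1], the cube of [sg * Rpower (sg * u) (1 / 3)]
   is still [u]. *)
assert (Hsg : exists sg, sg * sg = 1 /\ 0 < sg * u 0 0).
{ destruct (Rdichotomy _ _ Hu0); [exists (-1)|exists 1]; lra. }
destruct Hsg as [sg [Hsg1 Hsg]].
assert (Hsgu : smooth_on (box r) (fun x z => sg * u x z)).
{ apply smooth_on_mult; auto. now apply smooth_on_const. }
assert (H00 : box r (0, 0)) by now apply box_axis.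
destruct (proj1 (locally_2d_box _) (locally_2d_pos (fun x z => sg * u x z) 0 0
  (smooth_on_continuity _ _ _ _ Hsgu H00) Hsg)) as [r1 [Hr1 Hpos]].
set (r2 := Rmin r r1).
assert (Hr2 : 0 < r2 /\ r2 <= r /\ r2 <= r1).
{ split; [apply Rmin_pos; lra|]. split; [apply Rmin_l|apply Rmin_r]. }
pose proof (open_box r2) as Hor2.
set (k := fun x z => sg * Rpower (sg * u x z) (1 / 3)).
assert (Hk : smooth_on (box r2) k).
{ apply smooth_on_mult; auto; [now apply smooth_on_const|].
  apply (smooth_on_Rpower (box r2) (fun x z => sg * u x z)); auto.
  - apply smooth_on_subset with (box r); auto. intros p. apply box_le. lra.
  - intros x z Hxz. apply Hpos. apply box_le with r2; auto. lra. }
set (W := fun x z => z * k x z).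
assert (HW : smooth_on (box r2) W).
{ apply smooth_on_mult; auto. now apply smooth_on_snd. }
assert (H02 : box r2 (0, 0)) by (apply box_axis; rewrite Rabs_R0; lra).
assert (HW0 : dy W 0 0 <> 0).
{ unfold W. rewrite (dy_mult_snd r2) by assumption. rewrite Rmult_0_l, Rplus_0_r.
  apply Rmult_integral_contrapositive. split; [intros ->; lra|].
  apply Rgt_not_eq, exp_pos. }
destruct (proj1 (locally_2d_box _) (continuity_2d_pt_neq_0 (dy W) 0 0
  (smooth_on_continuity _ _ _ _ (smooth_on_dy _ _ HW) H02) HW0)) as [r3 [Hr3 HWne]].
destruct (Hshrink (Rmin r2 r3)) as [r4 [Hr4 [Hr4' Hr4b]]]; [apply Rmin_pos; lra|].
pose proof (Rmin_l r2 r3) as Hm2. pose proof (Rmin_r r2 r3) as Hm3.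
pose proof (open_box r4) as Hor4.
exists (fun x y => W x (y + - s x)). split.
- exists (box r4). split; [apply box_nbhd0; lra|]. split.
  + apply (smooth_on_comp (box r4) (box r2) W (fun x _ => x) (fun x y => y + - s x)); auto.
    * now apply smooth_on_fst.
    * apply smooth_on_plus; auto; [now apply smooth_on_snd|].
      apply smooth_on_opp; auto. apply (smooth1_subset e); auto. lra.
    * intros x y Hxy. apply box_le with (Rmin r2 r3); auto. now apply Hr4b.
  + intros x y Hxy. unfold dy. rewrite (Derive_ext _ (fun t => W x (t + - s x) + 0)).
    * rewrite Derive_shift. apply HWne. apply box_le with (Rmin r2 r3); auto. now apply Hr4b.
    * intros t. ring.
- apply locally_2d_box. exists r4. split; [lra|]. intros x y Hxy.
  destruct (Hr4b x y Hxy) as [_ Hb].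
  assert (Hb1 : box r (x, y + - s x)) by (apply box_le with (Rmin r2 r3); auto; lra).
  assert (Hb2 : box r1 (x, y + - s x)) by (apply box_le with (Rmin r2 r3); auto; lra).
  pose proof (Hfac _ _ Hb1) as H1. unfold h in H1.
  replace (y + - s x + s x) with y in H1 by ring.
  replace (g x y) with ((y + - s x) ^ 3 * u x (y + - s x) + beta x) by lra.
  f_equal. unfold W, k. rewrite !Rpow_mult_distr, Rpower_third_cube by now apply Hpos.
  replace (sg ^ 3) with (sg * sg * sg) by ring. rewrite Hsg1.
  transitivity ((y + - s x) ^ 3 * (sg * sg * u x (y + - s x))); [rewrite Hsg1|]; ring.
Qed.

Lemma admissible_normal_form g : admissible_discriminant g ->
  g 0 0 = 0 -> dy g 0 0 = 0 -> dy (dy g) 0 0 = 0 -> dy (dy (dy g)) 0 0 <> 0 ->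
  exists yt, second_coordinate yt /\
     (locally_2d (fun x y => g x y = yt x y ^ 3) 0 0 \/
      locally_2d (fun x y => g x y = yt x y ^ 3 + x ^ 2 / 4) 0 0).
Proof.
intros [L [U [HU [HL [HN Htd]]]]] g0 gy0 gyy0 gyyy0.
destruct (nijenhuis_discriminant_equations U g L (proj1 HU) HL Htd) as [HgU HE].
pose proof (proj1 HE HN) as E. destruct (nbhd0_box U HU) as [d [Hd HdU]].
assert (Hg : smooth_on (box d) g) by now apply smooth_on_subset with U.
assert (Hc : smooth_on (box d) (op21 L)) by (apply smooth_on_subset with U; [assumption|apply HL]).
assert (E0 : forall x y, box d (x, y) ->
  dx g x y * dx g x y + op21 L x y * dy g x y = g x y).
{ intros x y Hxy. destruct (Htd x y (HdU _ Hxy)) as [Ht Hdisc].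
  destruct (E x y (HdU _ Hxy)) as [Ea Eb]. rewrite <- Hdisc, Ht. unfold op_det.
  unfold op_tr in Ht. replace (op22 L x y) with (x - op11 L x y) by lra.
  rewrite Ea, Eb. field. }
destruct (critical_curve_system d g (op21 L) Hd Hg Hc E0 g0 gy0 gyy0 gyyy0)
  as [e [s [He [Hs [Hs0 [Hcrit [a [b [m Hsys]]]]]]]]].
destruct (cvs_critical_value _ _ _ _ _ _ Hsys) as [e' [He' [HA HB]]].
assert (Hs' : smooth1 e' s) by (apply (smooth1_subset e); auto; lra).
assert (He'd : 0 < e' <= d) by lra.
pose proof (open_box e') as Hop.
destruct HB as [HB|HB].
- destruct (cubic_normal_form d e' g s (fun _ => 0)) as [yt [Hyt Hloc]]; auto.
  + now apply (smooth_on_const (box e') 0).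
  + intros x Hx. split; [now apply HB|]. split; [now apply HA|]. apply Hcrit. lra.
  + exists yt. split; [assumption|left]. generalize Hloc. apply locally_2d_imp.
    intros x y ->. ring.
- destruct (cubic_normal_form d e' g s (fun x => x ^ 2 / 4)) as [yt [Hyt Hloc]]; auto.
  + apply (smooth_on_mult (box e') (fun x _ => x ^ 2)); auto.
    * apply (smooth_on_pow (box e') (fun x _ => x)); auto. now apply smooth_on_fst.
    * now apply smooth_on_const.
  + intros x Hx. split; [now apply HB|]. split; [now apply HA|]. apply Hcrit. lra.
  + exists yt. split; [assumption|now right].
Qed.

(** * The two normal forms and their operators *)

Lemma normal_form_L1 x z : operators_agree (normal_form 0) L1 x z.
Proof. repeat split; simpl; field. Qed.

Lemma normal_form_L2 x z : operators_agree (normal_form 1) L2 x z.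
Proof. repeat split; simpl; field. Qed.

(** Admissibility is witnessed by the transported normal form itself; the description of all
    operators composes the two characterisations by [pullback_normal_form]. *)
Lemma nijenhuis_matrix g eps M : eps * eps = eps ->
  (forall x z, operators_agree (normal_form eps) M x z) ->
  forall yt, second_coordinate yt ->
  locally_2d (fun x y => g x y = yt x y ^ 3 + eps * x ^ 2 / 4) 0 0 ->
  admissible_discriminant g /\
  forall L, nijenhuis_with_discriminant g L <-> matrix_in_coordinates yt L M.
Proof.
intros Heps HM yt Hyt Hg. split.
- exists (pullback_normal_form eps yt). apply (nijenhuis_normal_form g yt eps); auto.
  apply locally_2d_forall. intros x y. repeat split.
- intros L. rewrite (nijenhuis_normal_form g yt eps L Heps Hyt Hg).
  rewrite <- (matrix_in_coordinates_normal_form yt eps L Hyt).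
  split; apply matrix_in_coordinates_ext; auto.
  intros x z. destruct (HM x z) as [H1 [H2 [H3 H4]]]. repeat split; auto.
Qed.

Theorem theorem3p9 (g : R -> R -> R)
  (g_analytic : exists U, nbhd0 U /\ analytic_on U g)
  (g0 : g 0 0 = 0)
  (gy0 : dy g 0 0 = 0)
  (gyy0 : dy (dy g) 0 0 = 0)
  (gyyy0 : dy (dy (dy g)) 0 0 <> 0) :
  (admissible_discriminant g <->
   exists yt, second_coordinate yt /\
     (locally_2d (fun x y => g x y = yt x y ^ 3) 0 0 \/
      locally_2d (fun x y => g x y = yt x y ^ 3 + x ^ 2 / 4) 0 0)) /\
  (forall yt, second_coordinate yt ->
     locally_2d (fun x y => g x y = yt x y ^ 3) 0 0 ->
     forall L, nijenhuis_with_discriminant g L <->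
               matrix_in_coordinates yt L L1) /\
  (forall yt, second_coordinate yt ->
     locally_2d (fun x y => g x y = yt x y ^ 3 + x ^ 2 / 4) 0 0 ->
     forall L, nijenhuis_with_discriminant g L <->
               matrix_in_coordinates yt L L2).
Proof.
assert (H1 : forall yt, second_coordinate yt ->
  locally_2d (fun x y => g x y = yt x y ^ 3) 0 0 ->
  admissible_discriminant g /\
  forall L, nijenhuis_with_discriminant g L <-> matrix_in_coordinates yt L L1).
{ intros yt Hyt Hg. apply (nijenhuis_matrix g 0); auto using normal_form_L1; [ring|].
  generalize Hg. apply locally_2d_imp. intros x y ->. field. }
assert (H2 : forall yt, second_coordinate yt ->
  locally_2d (fun x y => g x y = yt x y ^ 3 + x ^ 2 / 4) 0 0 ->
  admissible_discriminant g /\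
  forall L, nijenhuis_with_discriminant g L <-> matrix_in_coordinates yt L L2).
{ intros yt Hyt Hg. apply (nijenhuis_matrix g 1); auto using normal_form_L2; [ring|].
  generalize Hg. apply locally_2d_imp. intros x y ->. field. }
split; [split|split].
- intros Ha. now apply admissible_normal_form.
- intros [yt [Hyt [Hg|Hg]]]; [now apply (H1 yt)|now apply (H2 yt)].
- intros yt Hyt Hg. now apply H1.
- intros yt Hyt Hg. now apply H2.
Qed.
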